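(* Let $x,a,b,c$ be non-negative integers and let $B_{x,a,b,c}$ be the region defined in the context. If $b$ is odd, then \[ \operatorname{M}(B_{x,a,b,c})=\operatorname{M}(P_{c,c,a})\frac{\operatorname{V}(2x+2a+b+2,c,\lfloor\frac{c+1}{2}\rfloor)}{\operatorname{V}(2a+b+2,c,\lfloor\frac{c+1}{2}\rfloor)}\cdot\frac{\operatorname{T}(x+1,2a+b+c,b)\,\operatorname{T}(x+a+\frac{b+3}{2},c-1,\lfloor\frac{c+1}{2}\rfloor)}{\operatorname{T}(1,2a+b+c,b)\,\operatorname{T}(a+\frac{b+3}{2},c-1,\lfloor\frac{c+1}{2}\rfloor)}, \] and if $b$ is even, then \[ \operatorname{M}(B_{x,a,b,c})=\operatorname{M}(P_{c,c,a})\frac{\operatorname{V}(2x+2a+b+3,c-1,\lfloor\frac{c+1}{2}\rfloor)}{\operatorname{V}(2a+b+3,c-1,\lfloor\frac{c+1}{2}\rfloor)}\cdot\frac{\operatorname{T}(x+1,2a+b+c,b)\,\operatorname{T}(x+a+\frac{b+2}{2},c,\lfloor\frac{c+1}{2}\rfloor)}{\operatorname{T}(1,2a+b+c,b)\,\operatorname{T}(a+\frac{b+2}{2},c,\lfloor\frac{c+1}{2}\rfloor)}. \]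
   Context: Notation. For real $x$ and integer $n$: $(x)_n=x(x+1)\cdots(x+n-1)$ if $n>0$, $(x)_0=1$, $(x)_n=1/((x-1)(x-2)\cdots(x+n))$ if $n<0$; $[x]_n=x(x+2)\cdots(x+2(n-1))$ if $n>0$, $[x]_0=1$, $[x]_n=1/((x-2)(x-4)\cdots(x+2n))$ if $n<0$. $\operatorname{T}(x,n,m)=\prod_{i=0}^{m-1}(x+i)_{n-2i}$ if $m>0$, $=1$ if $m=0$, $=\operatorname{T}(x,n,-m)^{-1}$ if $m<0$; $\operatorname{V}(x,n,m)=\prod_{i=0}^{m-1}[x+2i]_{n-2i}$ if $m>0$, $=1$ if $m=0$, $=\operatorname{V}(x,n,-m)^{-1}$ if $m<0$. Lattice and tilings. Regions lie on the triangular lattice drawn with one family of lattice lines horizontal. A lozenge is the union of two unit triangles sharing an edge; a lozenge tiling of a region is a covering of it by lozenges without gaps or overlaps. $\operatorname{M}(R)$ is the number of lozenge tilings of $R$ (for weighted regions, the sum over tilings of the product of the weights of the lozenges). A halved hexagon is a region whose western boundary is a vertical zigzag lattice path (unit segments alternating between the two non-horizontal lattice directions, running downward along a vertical line $\ell$), the other sides being lattice segments: a horizontal northern side, a northeastern side, a southeastern side, a horizontal southern side and possibly a southwestern side. A zigzag step consists of two consecutive unit segments of the zigzag; a removed half-triangle is the part to the right of $\ell$ of a lattice triangle bisected by $\ell$; it is said to be at level $k$ from the top if its horizontal side lies $k$ zigzag steps (i.e. $2k$ rows of unit triangles) below the northern side. $P_{a,b,c}$ (for $a\le b$): the semi-regular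 hexagon with side-lengths $a,b,c,a,b,c$ (counterclockwise starting from the northwestern side) with a maximal staircase cut off, so that it is a halved hexagon with a zigzag western side. (By Proctor's theorem, $\operatorname{M}(P_{a,b,c})=\prod_{i=1}^{a}[\prod_{j=1}^{b-a+1}\frac{c+i+j-1}{i+j-1}\prod_{j=b-a+2}^{b-a+i}\frac{2c+i+j-1}{i+j-1}]$.) $B_{x,a,b,c}$: take the halved hexagon whose northern, northeastern, southeastern, southern and southwestern sides have lengths $x+a,\ b+c,\ 2a+c+1,\ x,\ b$ respectively and whose western side is a zigzag lattice path of length $a+c+1$; then remove from the western side the right half of a down-pointing triangle of side $2a$, at level $c$ from the top. *)

(* Defs.v *)
From HB Require Import structures.
From mathcomp Require Import all_boot all_order all_algebra.
From mathcomp Require Import finmap.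

Set Implicit Arguments.
Unset Strict Implicit.
Unset Printing Implicit Defensive.

Import Order.TTheory GRing.Theory Num.Theory.
Local Open Scope fset_scope.
Local Open Scope ring_scope.

(* (x)_n, [x]_n, T(x,n,m) and V(x,n,m); [Negz k] is the integer -(k+1). *)

Definition poch (R : realFieldType) (x : R) (n : int) : R :=
  match n with
  | Posz k => \prod_(i < k) (x + i%:R)
  | Negz k => (\prod_(i < k.+1) (x - i.+1%:R))^-1
  end.

Definition poch2 (R : realFieldType) (x : R) (n : int) : R :=
  match n with
  | Posz k => \prod_(i < k) (x + 2 * i%:R)
  | Negz k => (\prod_(i < k.+1) (x - 2 * i.+1%:R))^-1
  end.

Definition Tprod (R : realFieldType) (x : R) (n m : int) : R :=
  let T0 (k : nat) := \prod_(i < k) poch (x + i%:R) (n - 2 * i%:Z) in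
  match m with Posz k => T0 k | Negz k => (T0 k.+1)^-1 end.

Definition Vprod (R : realFieldType) (x : R) (n m : int) : R :=
  let V0 (k : nat) := \prod_(i < k) poch2 (x + 2 * i%:R) (n - 2 * i%:Z) in
  match m with Posz k => V0 k | Negz k => (V0 k.+1)^-1 end.

(* The lattice point (i, j) lies j rows below the origin, at abscissa i + j/2:
   (1, 0) is the unit step to the east, (0, 1) the one to the southeast and
   (-1, 1) the one to the southwest. *)
Definition point : Type := (int * int)%type.

(* The lattice lines cut the unit rhombus with northwestern corner (i, j) into
   a down-pointing triangle, (i, j, false), and an up-pointing one to its
   right, (i, j, true). *)
Definition triangle : Type := (int * int * bool)%type.

Definition corners (t : triangle) : {fset point} :=
  let: (i, j, up) := t in
  if up then [fset (i + 1, j); (i, j + 1); (i + 1, j + 1)]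
  else [fset (i, j); (i + 1, j); (i, j + 1)].

Definition share_edge (s t : triangle) : bool :=
  #|` corners s `&` corners t| == 2%N.

Definition region : Type := {fset triangle}.

Definition lozenges (D : region) : {fset region} :=
  [fset [fset s; t] | s in D, t in D & share_edge s t].

Definition tilings (D : region) : {fset {fset region}} :=
  [fset L in fpowerset (lozenges D) | trivIfset L && (fcover L == D)].

Definition M (D : region) : nat := #|` tilings D|.

(* The halved hexagon whose northern side has length n and starts at the
   origin, whose northeastern and southeastern sides have lengths ne and se,
   and whose western zigzag, along the vertical line l : 2i + j = 0 through the
   origin, has m southwest segments (0,0)-(-1,1), (-1,2)-(-2,3), ...,
   (-m+1,2m-2)-(-m,2m-1), joined by southeast segments.  It consists of the
   unit triangles all of whose corners satisfy the inequalities below, which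
   correspond to the northern, southern, southwestern, northeastern,
   southeastern and western sides in this order.  The southern side runs from
   (-m, ne+se) to (n-se, ne+se), so its length is n - se + m; the southwestern
   side runs from the last zigzag vertex (-m, 2m-1) to (-m, ne+se), so its
   length is ne + se - (2m-1). *)
Definition halved_hexagon (n ne se m : nat) : region :=
  let inside (p : point) : bool :=
    let: (i, j) := p in
    [&& 0 <= j, j <= ne%:Z + se%:Z, - m%:Z <= i, i <= n%:Z,
        i + j <= n%:Z + ne%:Z & -1 <= 2 * i + j] in
  let window : seq point :=
    [seq (i%:Z - m%:Z, j%:Z) | i <- iota 0 (n + m), j <- iota 0 (ne + se)] in
  [fset t in [seq (p, up) | p <- window, up <- [:: false; true]]
     | all inside (corners t)].

(* t lies in the down-pointing lattice triangle of side s whose northwestern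
   corner is p. *)
Definition in_down_triangle (p : point) (s : nat) (t : triangle) : bool :=
  all (fun q : point =>
         [&& p.2 <= q.2, p.1 <= q.1 & q.1 + q.2 <= p.1 + p.2 + s%:Z])
      (corners t).

(* In the hexagon with sides a, b, c, a, b, c, a <= b, counterclockwise from
   the northwestern one, the northern, northeastern and southeastern sides have
   lengths c, b and a.  The staircase cut off is the part beyond the zigzag that
   descends from the northwestern corner (0, 0) of the hexagon to the point
   (-a, 2a) of its southwestern side; the last segment of this zigzag lies on
   that side. *)
Definition P_region (a b c : nat) : region := halved_hexagon c b a a.

(* The zigzag ends at the vertex (-(a+c+1), 2(a+c)+1), where the southwestern
   side begins; by the formulas above the southern and southwestern sides of
   the halved hexagon have lengths x and b.  The removed triangle has its top
   side centred at the point (-c, 2c) of l, c zigzag steps below the northern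
   side; the only unit triangles of the halved hexagon that are not to the right
   of l are those bisected by l. *)
Definition B_region (x a b c : nat) : region :=
  [fset t in halved_hexagon (x + a) (b + c) (2 * a + c + 1) (a + c + 1)
     | ~~ in_down_triangle (- c%:Z - a%:Z, 2 * c%:Z) (2 * a) t].

(* Main.v *)
Require Import Defs.
From mathcomp Require Import all_boot all_order all_algebra.
From mathcomp Require Import fingroup perm finmap.
From mathcomp Require Import zify ring lra.

(** The lozenges with a horizontal side chain up into non-intersecting lattice
    paths that descend from the northern side by unit steps to the southwest or
    southeast, are kept to the right of the zigzag, and end on the top of the
    notch or on the southern side.  Hence the number of tilings is a determinant
    of ballot numbers, and unitriangular column operations turn the columns of
    the notch into Catalan numbers.  Deleting the first or last row or column of
    this determinant gives a determinant of the same kind, so the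
    Desnanot-Jacobi identity is a recurrence
      M(x+1,a+1,c) M(x,a,c+2) = M(x,a+1,c) M(x+1,a,c+2) - M(x,a+1,c+1) M(x+1,a,c+1)
    for fixed b.  Its boundary values are a = 0, Proctor's theorem, which follows
    from a similar recurrence, and x = 0, where the determinant is that of
    P_{c,c,a}.  In the product formula every ratio that enters the recurrence
    telescopes, and what remains is a quadratic identity. *)

Set Implicit Arguments.
Unset Strict Implicit.
Unset Printing Implicit Defensive.

Import Order.TTheory GRing.Theory Num.Theory.
Local Open Scope fset_scope.
Local Open Scope nat_scope.

(** * Lozenge tilings and the expansion of [M] at one triangle *)

Lemma share_edge_sym s t : share_edge s t = share_edge t s.
Proof. by rewrite /share_edge fsetIC. Qed.

Lemma card_fsetI3 (T : choiceType) (A : {fset T}) (a b c : T) :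
  uniq [:: a; b; c] ->
  #|` A `&` [fset a; b; c]| = (a \in A) + (b \in A) + (c \in A).
Proof.
rewrite /= !inE negb_or andbT => /andP[/andP[ab ac] bc].
have -> : A `&` [fset a; b; c] = [fset x in [fset a; b; c] | x \in A].
  by apply/fsetP => x; rewrite !inE andbC.
rewrite card_fset_sum1 -big_fset_condE big_mkcond /=.
have -> : [fset a; b; c] = a |` (b |` [fset c]) by rewrite fsetUA.
rewrite !big_fsetU1 ?inE ?negb_or ?ab ?ac //= big_seq_fset1 -addnA.
by do 3!case: (_ \in A).
Qed.

Lemma card_corners t : #|` corners t| = 3.
Proof.
by case: t => [[i j] []]; rewrite -[X in #|` X|]fsetIid card_fsetI3 ?in_fsetE
  //=; rewrite ?inE ?xpair_eqE; lia.
Qed.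

Lemma share_edge_irr t : share_edge t t = false.
Proof. by rewrite /share_edge fsetIid card_corners. Qed.

Lemma lozengesP (D l : region) :
  reflect (exists s t, [/\ s \in D, t \in D, share_edge s t & l = [fset s; t]])
          (l \in lozenges D).
Proof.
apply: (iffP idP) => [/imfset2P[s sD [t]]|[s [t [sD tD st ->]]]].
  by rewrite inE => /andP[tD st] ->; exists s, t.
by apply/imfset2P; exists s => //; exists t => //; rewrite inE; apply/andP.
Qed.

Lemma tilingsP (D : region) (L : {fset region}) :
  reflect [/\ {subset L <= lozenges D},
              {in L &, forall k l t, t \in k -> t \in l -> k = l} &
              {in D, forall t, exists2 l, l \in L & t \in l}]
          (L \in tilings D).
Proof.
rewrite !inE /=; apply: (iffP and3P) => [[LD /trivIfsetP tI /eqP cD]|[LD tI cD]].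
  have {}LD : {subset L <= lozenges D} by apply/fsubsetP; rewrite -fpowersetE.
  split=> // [k l kL lL t tk tl|t].
    have [//|kl] := eqVneq (k : {fset triangle}) l.
    by move/fdisjointP: (tI _ _ kL lL kl) => /(_ t tk); rewrite tl.
  by rewrite -cD => /bigfcupP[l /andP[lL _] tl]; exists l.
split; first by rewrite fpowersetE; apply/fsubsetP.
  apply/trivIfsetP => k l kL lL /eqP kl; apply/fdisjointP => t tk.
  by apply/negP => tl; apply: kl; apply: tI tk tl.
apply/eqP/fsetP => t; apply/bigfcupP/idP => [[l /andP[lL _]]|/cD[l lL tl]].
  by have /lozengesP[s [u [sD uD _ ->]]] := LD _ lL; rewrite !inE => /orP[]/eqP->.
by exists l; rewrite ?lL.
Qed.

Lemma fset2_injr (T : choiceType) (t u v : T) :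
  t != u -> [fset t; u] = [fset t; v] -> u = v.
Proof.
move=> tu /fsetP/(_ u); rewrite !inE eqxx orbT => /esym/orP[/eqP|/eqP //].
by move=> e; rewrite e eqxx in tu.
Qed.

(** Adding and removing the lozenge [[fset t; u]] are inverse bijections. *)
Lemma tilings_mate (D : region) (t u : triangle) :
  t \in D -> u \in D -> share_edge t u ->
  #|` [fset L in tilings D | [fset t; u] \in L]|
    = M (D `\` [fset t; u]).
Proof.
move=> tD uD tu; set l0 := [fset t; u]; set D' := D `\` l0.
have tl0 : t \in l0 by rewrite !inE eqxx.
transitivity #|` [fset l0 |` L | L in tilings D']|; last first.
  rewrite card_in_imfset // => L1 L2 /tilingsP[LD1 _ _] /tilingsP[LD2 _ _] e.
  have nin (L : {fset region}) : {subset L <= lozenges D'} -> l0 \notin L.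
    move=> LD; apply/negP => /LD/lozengesP[p [q [+ _ _ e0]]].
    by rewrite in_fsetD e0 !inE eqxx.
  by rewrite -(fsetU1K (nin _ LD1)) e fsetU1K // nin.
apply: esym; congr (#|` _|); apply/fsetP => L.
apply/imfsetP/idP => /= [[L' /tilingsP[LD tI cD] ->]|].
  rewrite in_fset inE /= fset1U1 andbT.
  have dis l : l \in L' -> forall s, s \in l -> s \notin l0.
    move=> lL s; have /lozengesP[p [q [+ + _ ->]]] := LD _ lL.
    by rewrite [p \in _]in_fsetD [q \in _]in_fsetD => /andP[pl _] /andP[ql _];
       rewrite [s \in _]in_fset2 => /orP[]/eqP->.
  apply/tilingsP; split=> [l|k l|s sD].
  - rewrite in_fset1U => /orP[/eqP->|/LD/lozengesP[p [q [pD qD pq ->]]]].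
      by apply/lozengesP; exists t, u.
    apply/lozengesP; exists p, q; split=> //.
      by move: pD; rewrite in_fsetD => /andP[].
    by move: qD; rewrite in_fsetD => /andP[].
  - rewrite !in_fset1U => /orP[/eqP->|kL] /orP[/eqP->|lL] // s.
    + by move=> sl0 /(dis _ lL); rewrite sl0.
    + by move=> /(dis _ kL) /negPf->.
    + exact: tI.
  case: (boolP (s \in l0)) => [sl0|sl0].
    by exists l0 => //; rewrite in_fset1U eqxx.
  have [|l lL sl] := cD s; first by rewrite in_fsetD sl0.
  by exists l => //; rewrite in_fset1U lL orbT.
rewrite in_fset inE /= => /andP[/tilingsP[LD tI cD] l0L].
exists (L `\ l0); last by rewrite fsetD1K.
apply/tilingsP; split=> [l|k l|s].
- rewrite in_fsetD1 => /andP[ll0 lL].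
  have dis s : s \in l -> s \notin l0.
    by move=> sl; apply/negP=> /(tI _ _ lL l0L s sl) e; rewrite e eqxx in ll0.
  have /lozengesP[p [q [pD qD pq e]]] := LD _ lL.
  apply/lozengesP; exists p, q; split=> //; rewrite in_fsetD ?pD ?qD andbT.
    by apply: dis; rewrite e !inE eqxx.
  by apply: dis; rewrite e !inE eqxx orbT.
- by rewrite !in_fsetD1 => /andP[_ kL] /andP[_ lL]; apply: tI.
rewrite in_fsetD => /andP[sl0 /cD[l lL sl]]; exists l => //.
by rewrite in_fsetD1 lL andbT; apply/eqP => e; rewrite -e sl in sl0.
Qed.

(** In every tiling exactly one neighbour [u] forms a lozenge with [t], so a double sum over tilings
    and neighbours counts each tiling once. *)
Lemma M_expand (D : region) (t : triangle) : t \in D ->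
  M D = \sum_(u <- D | share_edge t u) M (D `\` [fset t; u]).
Proof.
move=> tD.
rewrite [LHS]card_fset_sum1.
transitivity (\sum_(L <- tilings D) \sum_(u <- D | share_edge t u) ([fset t;
  u] \in L : nat)).
  apply: eq_big_seq => L /tilingsP[LD tI cD].
  have [l lL tl] := cD _ tD.
  have [u [uD tu el]] : exists u, [/\ u \in D, share_edge t u & l = [fset t; u]].
    have /lozengesP[p [q [pD qD pq e]]] := LD _ lL.
    move: tl; rewrite e !inE => /orP[/eqP->|/eqP->]; first by exists q.
    by exists p; split=> //; rewrite 1?share_edge_sym // fsetUC.
  rewrite big_mkcond (big_fsetD1 u) //= tu -el lL big1_seq ?addn0 // => v /andP[_].
  rewrite in_fsetD1 => /andP[vu vD]; case: ifP => // tv.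
  apply/eqP; rewrite eqb0; apply/negP => vL.
  have tv0 : t \in [fset t; v] by rewrite !inE eqxx.
  have := tI _ _ lL vL t tl tv0; rewrite el => /fset2_injr e.
  move: vu; rewrite e ?eqxx //; apply/eqP => e'.
  by move: tu; rewrite e' share_edge_irr.
rewrite exchange_big /= big_seq_cond [RHS]big_seq_cond.
apply: eq_bigr => u /andP[uD tu]; rewrite -tilings_mate // card_fset_sum1.
rewrite -[RHS]big_fset_condE [RHS]big_mkcond.
by apply: eq_bigr => L _; case: (_ \in L).
Qed.

(** * Coordinates by rows, and local moves on cells *)

(* The cell (r, q) is the unit triangle of row r whose horizontal side has its
   midpoint at distance (q - 1)/2 to the right of the line l; it is up-pointing
   when r + q is odd. *)
Definition cell : Type := (nat * nat)%type.

Definition tri (c : cell) : triangle :=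
  ((Posz (c.1 + c.2)./2 - Posz c.1 - 1)%R, Posz c.1, odd (c.1 + c.2)).

(** Neighbours in a row share a slanted side; a horizontal side lies below an up-pointing cell and
    above a down-pointing one of the same column. *)
Definition adj (c d : cell) : bool :=
  (c.1 == d.1) && ((c.2 == d.2.+1) || (d.2 == c.2.+1))
  || (c.2 == d.2) && (odd (c.1 + c.2) && (d.1 == c.1.+1)
                      || odd (d.1 + d.2) && (c.1 == d.1.+1)).

Lemma tri_inj : injective tri.
Proof.
move=> [r q] [r' q']; rewrite /tri /= => -[e1 e2 e3].
have er : r = r' by lia.
by subst r'; congr (_, _); lia.
Qed.

Lemma share_edgeE (i j u v : int) (b b' : bool) :
  share_edge (i, j, b) ((i + u)%R, (j + v)%R, b') =
  if b' then ~~ b && ((v == 0%R) && ((u == 0%R) || (u == - 1%R)%R)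
                      || (u == 0%R) && (v == - 1%R)%R)
  else b && ((v == 0%R) && ((u == 0%R) || (u == 1%R)) || (u == 0%R) && (v == 1%R)).
Proof.
have e0 (k l : int) : (k + l + 1 == k)%R = (l == -1)%R by lia.
have e1 (k l : int) : (k + l + 1 == k + 1)%R = (l == 0)%R by lia.
have e2 (k l : int) : (k + l == k)%R = (l == 0)%R by lia.
have e3 (k l : int) : (k + l == k + 1)%R = (l == 1)%R by lia.
rewrite /share_edge; case: b b' => [] [];
  (rewrite card_fsetI3; last by rewrite /= !inE !xpair_eqE; lia);
  rewrite !inE !xpair_eqE !(e0, e1, e2, e3);
  (* Which corners coincide depends only on which of 0, 1, -1, if any, [u] and [v] are. *)
  (have [e|_] := u =P 0%R; [rewrite ?e|have [e|_] := u =P 1%R;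
    [rewrite ?e|have [e|_] := u =P (-1)%R; [rewrite ?e|]]]);
  (have [f|_] := v =P 0%R; [rewrite ?f|have [f|_] := v =P 1%R;
    [rewrite ?f|have [f|_] := v =P (-1)%R; [rewrite ?f|]]]) => //=.
Qed.

Lemma share_edge_tri c d : share_edge (tri c) (tri d) = adj c d.
Proof.
case: c d => [r q] [r' q']; rewrite /adj /tri /=.
set i := ((r + q)./2%:Z - r%:Z - 1)%R; set i' := ((r' + q')./2%:Z - r'%:Z - 1)%R.
have -> : i' = (i + (i' - i))%R by rewrite addrC subrK.
have -> : Posz r' = (Posz r + (Posz r' - Posz r))%R by lia.
rewrite share_edgeE /i' /i {i i'}.
have := odd_double_half (r + q); have := odd_double_half (r' + q').
by case: (odd (r + q)); case: (odd (r' + q')) => /=; lia.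
Qed.

Definition cellM (S : {fset cell}) : nat := M [fset tri c | c in S].

Lemma cellM_expand (S : {fset cell}) (c : cell) : c \in S ->
  cellM S = \sum_(d <- S | adj c d) cellM (S `\` [fset c; d]).
Proof.
move=> cS; have tS : tri c \in [fset tri c | c in S] by apply: in_imfset.
rewrite /cellM (M_expand tS) big_mkcond big_imfset /=; last by move=> ? ? _ _;
  apply: tri_inj.
rewrite -big_mkcond; apply: eq_big => [d|d _]; first exact: share_edge_tri.
congr M; apply/fsetP => t; apply/fsetDP/imfsetP => /=.
  move=> [/imfsetP[e /= eS ->]]; rewrite !inE !(inj_eq tri_inj) => ecd.
  by exists e => //; rewrite in_fsetD eS in_fset2 ecd.
move=> [e]; rewrite in_fsetD => /andP[ecd eS] ->; split.
  by apply/imfsetP; exists e.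
by rewrite !inE !(inj_eq tri_inj) -in_fset2.
Qed.

Lemma cellM_forced (S : {fset cell}) (c d : cell) :
  c \in S -> d \in S -> adj c d -> {in S, forall e, adj c e -> e = d} ->
  cellM S = cellM (S `\` [fset c; d]).
Proof.
move=> cS dS cd uniq_d; rewrite (cellM_expand cS) big_mkcond (big_fsetD1 d) //= cd.
rewrite big1_seq ?addn0 // => e /andP[_]; rewrite in_fsetD1 => /andP[ed eS].
by case: ifP => // /(uniq_d _ eS) e'; rewrite e' eqxx in ed.
Qed.

(** With its lower neighbour gone, an up-pointing cell pairs to the left or to the right; these two
    terms match the ballot recurrence. *)
Lemma cellM_row_step (S : {fset cell}) (r q : nat) :
  (r, q.+1) \in S -> odd (r + q.+1) -> (r.+1, q.+1) \notin S ->
  cellM S = (if (r, q) \in S then cellM (S `\` [fset (r, q.+1); (r, q)]) else 0)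
        + (if (r, q.+2) \in S then cellM (S `\` [fset (r, q.+1); (r,
            q.+2)]) else 0).
Proof.
move=> cS oc nS; rewrite (cellM_expand cS).
have adjE d : d \in S -> adj (r, q.+1) d = (d == (r, q)) || (d == (r, q.+2)).
  move=> dS; have : d != (r.+1, q.+1) by apply: contraNneq nS => <-.
  by case: d {dS} => r' q'; rewrite /adj !xpair_eqE /=; lia.
set F := fun d => cellM (S `\` [fset (r, q.+1); d]).
rewrite -/(F (r, q)) -/(F (r, q.+2)).
transitivity (\sum_(d <- S) (if d == (r, q) then F d else 0)
              + \sum_(d <- S) (if d == (r, q.+2) then F d else 0)).
  rewrite -big_split big_mkcond; apply: eq_big_seq => d /adjE ->.
  case: eqP => [->|_] //=.
  by rewrite xpair_eqE eqxx /= ifF ?addn0 //; lia.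
have pick d : \sum_(e <- S) (if e == d then F e else 0)
  = if d \in S then F d else 0.
  case: ifP => dS; last first.
    by apply: big1_seq => e /andP[_ eS]; case: eqP => // e'; rewrite -e' eS in dS.
  rewrite (big_fsetD1 d) //= eqxx big1_seq ?addn0 // => e /andP[_].
  by rewrite in_fsetD1 => /andP[/negPf->].
by rewrite !pick.
Qed.

Lemma cellM0 : cellM fset0 = 1.
Proof.
rewrite /cellM /M.
have -> : [fset tri c | c in fset0] = fset0 :> region.
  by apply/fsetP => t; rewrite in_fset0; apply/imfsetP => -[].
suff -> : tilings fset0 = [fset fset0] by rewrite cardfs1.
apply/fsetP => L; rewrite in_fset1; apply/tilingsP/eqP => [[LD _ _]|->].
  apply/eqP; rewrite -fsubset0; apply/fsubsetP => l /LD /lozengesP[s [t [sD]]].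
  by rewrite in_fset0 in sD.
by split.
Qed.

(** * Ballot numbers and determinants of path heads *)

(* The number of walks with N steps +1 or -1 from 1 to q that avoid 0. *)
Fixpoint ballot (N q : nat) : nat :=
  match N, q with
  | 0, _ => q == 1
  | _.+1, 0 => 0
  | N'.+1, q'.+1 => ballot N' q' + ballot N' q'.+2
  end.

Lemma ballot_wall N : ballot N 0 = 0. Proof. by case: N. Qed.

Lemma ballotS N q : ballot N.+1 q.+1 = ballot N q + ballot N q.+2.
Proof. by []. Qed.

Lemma ballot_far N q : N.+1 < q -> ballot N q = 0.
Proof.
elim: N q => [|N IH] [|q] //= Nq; first by case: q Nq => [|[]].
by rewrite !IH //; lia.
Qed.

Lemma ballot_top N : ballot N N.+1 = 1.
Proof. by elim: N => //= N ->; rewrite ballot_far. Qed.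

Section HeadDet.
Variable R : comRingType.
Local Open Scope ring_scope.

(* A head (l, q) is a horizontal edge at level l.  The k-th path is prolonged
   above the northern side up to the edge q = 1 at level - (2 k + 1), so that the
   entries are ballot numbers. *)
Definition path_det (n : nat) (hs : seq (nat * nat)) : R :=
  \det (\matrix_(i < n, k < n)
    (ballot ((nth (0, 0) hs i).1 + k.*2 + 1)%N (nth (0, 0) hs i).2)%:R).

(** The ballot recurrence splits the row of this head, and the determinant is linear in that row. *)
Lemma path_det_step n A l q B : (size A < n)%N ->
  path_det n (A ++ (l.+1, q.+1) :: B)
  = path_det n (A ++ (l, q) :: B) + path_det n (A ++ (l, q.+2) :: B).
Proof.
move=> An; set i0 := Ordinal An.
have nthx h : nth (0, 0)%N (A ++ h :: B) i0 = h by rewrite nth_cat ltnn subnn.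
have nthy h h' i : nth (0, 0)%N (A ++ h :: B) (lift i0 i) = nth (0, 0)%N (A
  ++ h' :: B) (lift i0 i).
  rewrite !nth_cat; case: ltnP => // Ai.
  have ne : nat_of_ord (lift i0 i) <> size A.
    by move=> e; have /eqP := neq_lift i0 i; apply; apply: val_inj.
  by rewrite (_ : (lift i0 i - size A)%N = (lift i0 i - size A).-1.+1) //; lia.
rewrite -[path_det n (A ++ (l, q) :: B)]mul1r -[path_det n (A ++ (l,
  q.+2) :: B)]mul1r.
apply: (determinant_multilinear (i0 := i0)).
- by rewrite !scale1r; apply/rowP => k; rewrite !mxE !nthx /= -natrD.
- by apply/matrixP => i k; rewrite !mxE (nthy _ (l.+1, q.+1)).
- by apply/matrixP => i k; rewrite !mxE (nthy _ (l.+1, q.+1)).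
Qed.

(** The row vanishes: no walk ends on the wall, and even the longest prolongation, [k = n - 1],
    reaches at most column [l + 2 n]. *)
Lemma path_det_row0 n A l q B : (size A < n)%N -> (q == 0) || (l + n.*2 < q)%N ->
  path_det n (A ++ (l, q) :: B) = 0.
Proof.
move=> An q0; rewrite /path_det (expand_det_row _ (Ordinal An)) big1 // => k _.
rewrite mxE nth_cat ltnn subnn /=.
have -> : ballot (l + k.*2 + 1) q = 0%N; last by rewrite mul0r.
case/orP: q0 => [/eqP->|ql]; first exact: ballot_wall.
by apply: ballot_far; have := ltn_ord k; lia.
Qed.

Lemma path_det_dup n hs i j : (i < j < n)%N -> nth (0, 0)%N hs i = nth (0,
  0)%N hs j ->
  path_det n hs = 0.
Proof.
move=> /andP[ij jn] e.
apply: (@determinant_alternate _ _ _ (Ordinal (ltn_trans ij jn)) (Ordinal jn)).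
  by rewrite -val_eqE /= neq_ltn ij.
by move=> k; rewrite !mxE /= e.
Qed.

(** The [k]-th starting edge reaches at most column [2 k + 2], and that column in one way, so the
    matrix is unitriangular. *)
Lemma path_det_top n : path_det n [seq (0, i.*2.+2)%N | i <- iota 0 n] = 1.
Proof.
rewrite /path_det -det_tr det_trig.
  rewrite big1 // => i _; rewrite !mxE (nth_map 0) ?size_iota // nth_iota //=.
  by rewrite add0n addn1 ballot_top.
apply/is_trig_mxP => i j ij; rewrite !mxE (nth_map 0) ?size_iota // nth_iota //=.
by rewrite ballot_far // !add0n; lia.
Qed.

(* The row of a head inside the notch is a combination of the rows of the heads
   on the top side of the notch. *)
Lemma path_det_notch n a c t q A B :
  (a + size A < n)%N -> (q + t <= a.*2)%N -> ~~ odd (q + t) ->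
  path_det n ([seq (c, i.*2.+2) | i <- iota 0 a] ++ A ++ ((c + t)%N, q) :: B) = 0.
Proof.
set W := map _ _ => An; have sW : size W = a by rewrite size_map size_iota.
have WAn : (size (W ++ A) < n)%N by rewrite size_cat sW.
elim: t q => [|t IH] [|q] qt oqt.
- by rewrite catA path_det_row0.
(* At [t = 0] the edge is on the top side of the notch, with index [q./2], so a row repeats. *)
- apply: (@path_det_dup _ _ q./2 (size (W ++ A))); first by rewrite size_cat sW;
    lia.
  rewrite nth_cat sW ifT; last by lia.
  rewrite (nth_map 0) ?size_iota; last by lia.
  rewrite nth_iota; last by lia.
  rewrite catA nth_cat ltnn subnn /= addn0; congr (_, _); lia.
- by rewrite catA path_det_row0.
by rewrite addnS catA path_det_step // -!catA !IH ?addr0 //; lia.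
Qed.
End HeadDet.

(** Up-pointing cells are absent from row [r.+1], so a down-pointing cell of this row can only pair
    with the cell above it. *)
Lemma cellM_forced_row (S : {fset cell}) (r : nat) (L : seq nat) :
  uniq L ->
  (forall q, q \in L -> [/\ (r, q) \in S, (r.+1, q) \in S & odd (r + q)]) ->
  (forall q, odd (r + q) -> (r.+1, q.+1) \notin S /\ (r.+1, q.-1) \notin S) ->
  cellM S = cellM [fset c in S | ~~ ((r <= c.1 <= r.+1) && (c.2 \in L))].
Proof.
elim: L S => [|q L IH] S /=.
  move=> _ _ _; congr cellM; apply/fsetP => c; rewrite !inE.
  by rewrite andbF andbT.
move=> /andP[qL uL] HL Hrow.
have [|rS r1S oq] := HL q; first by rewrite inE eqxx.
have [n1 n2] := Hrow _ oq.
rewrite (@cellM_forced _ (r.+1, q) (r, q)) //; first last.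
- move=> [r' q'] S'; rewrite /adj /= => h; congr (_, _); move: h.
    case: (r' =P r.+1) => [e|] ; last by lia.
    subst r'; case: (q' =P q.+1) => [e|]; first by rewrite -e S' in n1.
    case: (q' =P q.-1) => [e|]; first by rewrite -e S' in n2.
    by lia.
  case: (r' =P r.+1) => [e|] ; last by lia.
  subst r'; case: (q' =P q.+1) => [e|]; first by rewrite -e S' in n1.
  case: (q' =P q.-1) => [e|]; first by rewrite -e S' in n2.
  by lia.
- by rewrite /adj /=; lia.
rewrite IH //.
- congr cellM; apply/fsetP => -[r' q']; rewrite !inE !xpair_eqE /=.
  by case: (_ \in S) => //=; rewrite ?andbF //; lia.
- move=> p pL; have [|pS p1S op] := HL p; first by rewrite inE pL orbT.
  have pq : p != q by apply: contraNneq qL => <-.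
  by split=> //; rewrite !inE !xpair_eqE ?pS ?p1S (negPf pq) ?andbF.
- by move=> p op; have [m1 m2] := Hrow _ op;
    rewrite !inE (negPf m1) (negPf m2) !andbF.
Qed.

Lemma in_fset_sep (T : choiceType) (S : {fset T}) (P : pred T) t :
  (t \in [fset u in S | P u]) = (t \in S) && P t.
Proof. by rewrite in_fset. Qed.

Lemma evens_unique m (Z : seq nat) :
  pairwise ltn Z -> all (fun q => [&& ~~ odd q, 1 < q & q <= m.*2]) Z ->
  size Z = m -> Z = [seq i.*2.+2 | i <- iota 0 m].
Proof.
rewrite -sorted_pairwise; last exact: ltn_trans.
move=> sZ /allP aZ szZ; set E := map _ _.
have sE : sorted ltn E.
  rewrite /E sorted_map; apply: (sub_sorted _ (iota_ltn_sorted 0 m)) => i j /=.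
  by lia.
have mE q : (q \in E) = [&& ~~ odd q, 1 < q & q <= m.*2].
  apply/mapP/and3P => [[i]|[oq q0 qm]]; first by rewrite mem_iota => ? ->;
    split; lia.
  by exists q./2.-1; rewrite ?mem_iota; lia.
apply: (irr_sorted_eq ltn_trans ltnn) => // q.
have uZ : uniq Z by apply: sorted_uniq sZ; [apply: ltn_trans | apply: ltnn].
have sub : {subset Z <= E} by move=> p; rewrite mE; apply: aZ.
by have [|_ ->] := uniq_min_size uZ sub; rewrite ?size_map ?size_iota ?szZ.
Qed.

(** * Peeling the rows of B from the bottom up *)

Section Peel.
Variables (x a b c : nat).
Let n := x + a.
Let H := 2 * a + 2 * c + b + 1.

(** The clauses express, in order, the southern side ([H] is the number of rows), the line l, the
    notch, and the southwestern, northeastern and southeastern sides. *)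
Definition in_B (d : cell) : bool :=
  let: (r, q) := d in
  [&& r < 2 * a + 2 * c + b + 1, 1 <= q, (r < 2 * c) || (2 * (a + c) < r + q),
      r <= q + 2 * a + 2 * c, q <= 2 * (x + a) + r + 1
    & q + r <= 2 * (x + a + b + c)].

Arguments in_B : simpl never.

Definition B_cells : {fset cell} :=
  [fset d in [seq (r, q) | r <- iota 0 H,
    q <- iota 0 (2 * (x + a + b + c)).+1] | in_B d].

Lemma in_B_cells d : (d \in B_cells) = in_B d.
Proof.
rewrite /B_cells; set s := flatten _.
have -> : (d \in [fset d in s | in_B d]) = (d \in s) && in_B d by rewrite in_fset.
apply/andb_idl; case: d => r q rq.
apply/allpairsP; exists (r, q); rewrite !mem_iota /H; split=> //; move: rq;
  rewrite /in_B /=; lia.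
Qed.

(* What is left of B when the tiling has been built from the bottom up to row r:
   the down-pointing cells Y of this row are already covered, its up-pointing
   cells X are those that are not paired with a cell of the row below. *)
Definition stage (r : nat) (Y X : seq nat) : {fset cell} :=
  [fset d in B_cells | (d.1 < r) || (d.1 == r)
     && (if odd (r + d.2) then d.2 \in X else d.2 \notin Y)].

Lemma stageE r Y X d : (d \in stage r Y X) =
  in_B d && ((d.1 < r) || (d.1 == r)
     && (if odd (r + d.2) then d.2 \in X else d.2 \notin Y)).
Proof. by rewrite -in_B_cells in_fset inE. Qed.

Definition notch : seq nat := [seq i.*2.+2 | i <- iota 0 a].

(* In the rows below level 2 c the heads on the top side of the notch wait until
   the other heads have come up to their level. *)
Definition waiting (r : nat) : seq (nat * nat) :=
  if 2 * c <= r then [seq (2 * c, q) | q <- notch] else [::].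

Lemma mem_notch q : (q \in notch) = [&& ~~ odd q, 0 < q & q <= 2 * a].
Proof.
apply/mapP/and3P => [[i]|[oq q0 qa]]; first by rewrite mem_iota => ? ->; split; lia.
by exists q./2.-1; rewrite ?mem_iota; lia.
Qed.

Lemma notch_pairwise : pairwise ltn notch.
Proof.
rewrite /notch pairwise_map -sorted_pairwise => [|i j k /=]; last by lia.
by apply: (sub_sorted _ (iota_ltn_sorted 0 a)) => i j /=; lia.
Qed.

(** With no up-pointing cell left in row [r.+1], its uncovered down-pointing cells pair upwards. The
    cells of row [r] that stay unpaired are those above [Y] and, at level [2 c], those above the
    notch. *)
Lemma cellM_next_row r Y : r.+1 < H ->
  all (fun q => in_B (r.+1, q) && ~~ odd (r.+1 + q)) Y ->
  cellM (stage r.+1 Y [::])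
  = cellM (stage r [::] ((if r.+1 == 2 * c then notch else [::]) ++ Y)).
Proof.
move=> rH /allP HY.
set L := [seq q <- iota 0 (2 * (x + a + b + c)).+1 | [&& in_B (r.+1, q),
  odd (r + q) & q \notin Y]].
have memL q : (q \in L) = [&& in_B (r.+1, q), odd (r + q) & q \notin Y].
  rewrite mem_filter mem_iota; apply/andb_idr => /and3P[+ _ _].
  by rewrite /in_B; lia.
rewrite (@cellM_forced_row _ r L).
- congr cellM; apply/fsetP => -[r' q]; rewrite in_fset_sep !stageE /= memL mem_cat.
  case: (ltngtP r' r) => [h|h|->] /=.
  - by rewrite ltnS ltnW // ?andbT.
  - rewrite ltnS leqNgt h /= andbF; case: (r' =P r.+1) => [->|_] /=; last
      by rewrite andbF.
    case: (odd (r + q)); rewrite /= ?ltnn ?leqnn ?andbF ?in_nil ?andbF //=.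
      by rewrite andbN.
  rewrite ltnSn leqnSn /=; case: (boolP (odd (r + q))) => oq; last
    by rewrite ?andbF ?andbT.
  case: (boolP (q \in Y)) => qY; first by rewrite ?andbF ?orbT ?andbT.
  rewrite orbF andbT andTb.
  case: (r.+1 =P 2 * c) => rc; rewrite ?mem_notch ?in_nil /in_B; lia.
- by rewrite filter_uniq // iota_uniq.
- move=> q; rewrite memL !stageE /= => /and3P[Bq oq qY];
    rewrite Bq qY oq ltnSn eqxx andbT.
  split; rewrite /= ?orbT //; move: Bq oq; rewrite /in_B; lia.
move=> q oq; rewrite !stageE /= !ltnn !eqxx /=; split.
  by rewrite ifT ?in_nil ?andbF //; lia.
case: q oq => [|q] oq; first by rewrite /in_B andbF.
by rewrite ifT ?in_nil ?andbF //=; lia.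
Qed.

Section Count.
Variable R : comRingType.
Local Notation pdet := (path_det R n).

Lemma stage_remove r Y X p q :
  p.+1 \notin X -> ~~ odd (r + q) -> odd (r + p.+1) ->
  stage r Y (p.+1 :: X) `\` [fset (r, p.+1); (r, q)] = stage r (rcons Y q) X.
Proof.
move=> pX oq op; apply/fsetP => -[r' s].
rewrite in_fsetD !stageE in_fset2 !xpair_eqE /= mem_rcons !inE negb_or.
case: (in_B _); rewrite ?andbF //=; case: (ltngtP r' r) => //= _.
rewrite -negb_or; case: (s =P p.+1) => [->|_] /=; first by rewrite op (negPf pX).
case: (s =P q) => [->|_] //=; by rewrite (negPf oq).
Qed.

(** The left neighbour is missing at the line l, where the row is zero, or in the notch, where the
    row depends on those of the waiting heads. Parity rules out the southwestern side. *)
Lemma waiting_blocks r q A B :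
  in_B (r, q.+1) -> ~~ in_B (r, q) -> odd (r + q.+1) ->
  size (waiting r ++ A) < n ->
  pdet (waiting r ++ A ++ (r, q) :: B) = 0%R.
Proof.
rewrite /waiting => Bq1 Bq oq; case: ifP => rc sz; last first.
  by rewrite path_det_row0 //; move: Bq1 Bq oq; rewrite /in_B; lia.
rewrite size_cat !size_map size_iota in sz.
case: q => [|q] in Bq1 Bq oq *.
  by rewrite catA path_det_row0 // size_cat !size_map size_iota.
rewrite -[X in (X, q.+1)](subnKC rc) -map_comp.
by apply: path_det_notch => //; move: Bq1 Bq oq; rewrite /in_B; lia.
Qed.

(** The cells of [X] are paired from left to right, each choice being one term of [path_det_step]; a
    choice that the region forbids has determinant zero. [base] takes over when [X] is exhausted. *)
Lemma cellM_row r (Y X : seq nat) :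
  r < H ->
  (forall Z, pairwise ltn Z -> all (fun q => in_B (r, q) && ~~ odd (r + q)) Z ->
    size (waiting r) + size Z = n ->
    (cellM (stage r Z [::]))%:R%R = pdet (waiting r ++ [seq (r, q) | q <- Z])) ->
  pairwise ltn (Y ++ X) ->
  all (fun q => in_B (r, q) && ~~ odd (r + q)) Y ->
  all (fun q => in_B (r, q) && odd (r + q)) X ->
  size (waiting r) + size Y + size X = n ->
  (cellM (stage r Y X))%:R%R
    = pdet (waiting r ++ [seq (r, q) | q <- Y] ++ [seq (r.+1, q) | q <- X]).
Proof.
move=> rH base; elim: X Y => [|z X IH] Y.
  by rewrite !cats0 /= addn0 => sY aY _ sz; rewrite base.
case: z => [|q]; first by move=> _ _ /=; rewrite {1}/in_B /= !andbF.
move=> sYX aY /andP[/andP[Bq oq] aX] sz.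
have szA : size (waiting r ++ [seq (r, q) | q <- Y]) < n.
  by rewrite size_cat size_map; move: sz; clear => /=; lia.
move: sYX; rewrite pairwise_cat allrel_consr /= => /and4P[/andP[/allP Yq YX] pY
  /allP qX pX].
have qnX : q.+1 \notin X by apply/negP => /qX; rewrite /= ltnn.
have IHstep p : q <= p -> p <= q.+2 -> in_B (r, p) -> p \notin Y
  -> ~~ odd (r + p) ->
    (cellM (stage r (rcons Y p) X))%:R%R
    = pdet (waiting r ++ [seq (r, q) | q <- Y] ++ (r, p) :: [seq (r.+1,
      q) | q <- X]).
  move=> qp pq Bp pnY op; rewrite IH //.
  - by rewrite map_rcons cat_rcons.
  - rewrite cat_rcons pairwise_cat allrel_consr /= YX pY pX !andbT; apply/andP;
      split.
      apply/allP => y yY /=; have /= := Yq _ yY; have : y != p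
        by apply: contraNneq pnY => <-.
      by move: qp; clear; lia.
    apply/allP => y yX /=; have /= := qX _ yX; have /andP[_] := allP aX _ yX.
    by move: op pq; clear; lia.
  - by rewrite all_rcons aY Bp op.
  - by rewrite size_rcons -sz /=; clear; lia.
rewrite (@cellM_row_step _ r q) //; first last.
- by rewrite stageE /= ltnNge leqnSn gtn_eqF ?andbF.
- by rewrite stageE /= Bq ltnn eqxx oq inE eqxx.
rewrite natrD catA path_det_step // -!catA.
have oq0 : ~~ odd (r + q) by move: oq; clear; lia.
have oq2 : ~~ odd (r + q.+2) by move: oq; clear; lia.
congr (_ + _)%R.
- rewrite stageE /= ltnn eqxx (negPf oq0) /=.
  case: (boolP (in_B (r, q))) => Bq0 /=; last by rewrite waiting_blocks.
  (* If [q] was taken by the preceding head, two paths meet and two rows agree. *)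
  case: (boolP (q \in Y)) => qY /=; last
    by rewrite stage_remove // IHstep // (leqW (leqnSn q)).
  have iY := index_mem q Y; rewrite qY in iY.
  rewrite (@path_det_dup _ _ _ (size (waiting r) + index q Y) (size (waiting r)
    + size Y)) //.
    by rewrite ltn_add2l iY /=; move: szA; rewrite size_cat size_map.
  have nW s k : nth (0, 0) (waiting r ++ s) (size (waiting r) + k) = nth (0, 0) s k.
    by rewrite nth_cat ltnNge leq_addr /= addKn.
  rewrite !nW nth_cat size_map iY (nth_map 0) // nth_index //.
  by rewrite nth_cat size_map ltnn subnn.
rewrite stageE /= ltnn eqxx (negPf oq2) /=.
have q2Y : q.+2 \notin Y by apply/negP => /Yq /=; rewrite ltnNge leqnSn.
rewrite q2Y andbT; case: (boolP (in_B (r, q.+2))) => Bq2.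
  by rewrite stage_remove // IHstep // (leqW (leqnSn q)).
(* By parity only the northeastern side can exclude [q.+2], which then exceeds the reach
   [r + 2 n]. *)
by rewrite catA path_det_row0 //; move: Bq Bq2 oq; rewrite /in_B /n; clear; lia.
Qed.

Lemma cellM_rows r (Y X : seq nat) :
  r < H -> pairwise ltn (Y ++ X) ->
  all (fun q => in_B (r, q) && ~~ odd (r + q)) Y ->
  all (fun q => in_B (r, q) && odd (r + q)) X ->
  size (waiting r) + size Y + size X = n ->
  (cellM (stage r Y X))%:R%R
    = pdet (waiting r ++ [seq (r, q) | q <- Y] ++ [seq (r.+1, q) | q <- X]).
Proof.
elim: r Y X => [|r IHr] Y X rH; apply: cellM_row => // {Y X} Y pY aY sz.
  set Z := (if 2 * c <= 0 then notch else [::]) ++ Y.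
  have eW : waiting 0 ++ [seq (0, q) | q <- Y] = [seq (0, q) | q <- Z].
    by rewrite /waiting /Z map_cat; case: ifP => // c0; rewrite (_ : 2 * c
      = 0) //; lia.
  (* There are only [n] even columns from 2 to [2 n], so the heads fill the northern side. *)
  have eZ : Z = [seq i.*2.+2 | i <- iota 0 n].
    apply: evens_unique; rewrite /Z.
    - case: ifP => // c0; rewrite pairwise_cat notch_pairwise pY !andbT.
      apply/allrelP => p q pN qY; have /andP[] := allP aY _ qY.
      by move: pN; rewrite mem_notch /in_B; lia.
    - rewrite all_cat; apply/andP; split.
        case: ifP => // _; apply/allP => q; rewrite mem_notch /n; lia.
      by apply/allP => q /(allP aY) /=; rewrite /in_B /n; lia.
    - by rewrite -sz size_cat /waiting; case: ifP => //; rewrite !size_map.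
  rewrite eW eZ -map_comp path_det_top.
  suff -> : stage 0 Y [::] = fset0 by rewrite cellM0.
  apply/fsetP => -[r q]; rewrite stageE in_fset0 /=.
  case: r => [|r] /=; last by rewrite andbF.
  case: ifP => oq; first by rewrite in_nil andbF.
  apply/negP => /andP[Bq qY]; have : q \in Z.
    rewrite eZ; apply/mapP; exists q./2.-1; rewrite ?mem_iota; move: Bq oq;
      rewrite /in_B /n; lia.
  rewrite mem_cat (negPf qY) orbF; case: ifP => // c0.
  by rewrite mem_notch; move: Bq c0; rewrite /in_B; lia.
rewrite cellM_next_row // IHr ?(ltnW rH) //.
- congr path_det; rewrite /waiting; case: (r.+1 =P 2 * c) => [e|ne] /=.
    by rewrite -e ltnn leqnn /= map_cat.
  by rewrite [2 * c <= r.+1]leq_eqVlt eq_sym; case: eqP => [e|_]; rewrite ?ltnS.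
- rewrite cat0s; case: eqP => // e; rewrite pairwise_cat notch_pairwise pY !andbT.
  apply/allrelP => p q pN qY; have /andP[] := allP aY _ qY.
  by move: pN; rewrite mem_notch /in_B; lia.
- rewrite all_cat; apply/andP; split.
    case: eqP => // e; apply/allP => q; rewrite mem_notch => qN; rewrite /in_B; lia.
  by apply/allP => q /(allP aY) /=; rewrite /in_B; lia.
rewrite -sz addn0 size_cat /waiting addnA; congr (_ + _); move: rH.
by case: (r.+1 =P 2 * c) => e; do 2?case: ifP => //=; rewrite ?size_map; lia.
Qed.
End Count.
End Peel.

(** * The regions in cell coordinates and their path determinants *)

Lemma all_fset3 (T : choiceType) (P : pred T) (p q r : T) :
  all P [fset p; q; r] = [&& P p, P q & P r].
Proof.
apply/allP/and3P => [h|[hp hq hr] t]; last by rewrite !inE => /orP[/orP[]|] /eqP->.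
by split; apply: h; rewrite !inE eqxx ?orbT.
Qed.

Lemma in_halved_hexagon n ne se m (i j : int) (up : bool) :
  ((i, j, up) \in halved_hexagon n ne se m) =
  [&& (0 <= j)%R, (j + 1 <= Posz ne + Posz se)%R, (- Posz m <= i)%R,
    (i + 1 <= Posz n)%R,
      (i + j + 1 + up%:R <= Posz n + Posz ne)%R & (-1 <= 2 * i + j + up%:R)%R].
Proof.
rewrite /halved_hexagon; set s := flatten _.
pose ins (p : point) : bool := let: (i, j) := p in
  [&& 0 <= j, j <= Posz ne + Posz se, - Posz m <= i, i <= Posz n,
      i + j <= Posz n + Posz ne & -1 <= 2 * i + j]%R.
rewrite (_ : (_ \in _) = ((i, j, up) \in s) && all ins (corners (i, j, up)));
  last by rewrite in_fset.
apply/andP/idP => [[_]|h].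
  by rewrite /ins; case: up; rewrite /= all_fset3 /=; lia.
split; last by rewrite /ins; move: h; case: up; rewrite /= all_fset3 /=; lia.
apply/allpairsP; exists ((i, j), up); split=> //; last by case: up {h}.
apply/allpairsP; exists (`|(i + Posz m)%R|%N, `|j|%N); rewrite !mem_iota;
  split=> /=; [lia|lia|].
by congr (_, _); lia.
Qed.

Lemma in_down_triangleE (i0 j0 : int) s (i j : int) (up : bool) :
  in_down_triangle (i0, j0) s (i, j, up) =
  [&& (j0 <= j)%R, (i0 <= i)%R & (i + j + 1 + up%:R <= i0 + j0 + Posz s)%R].
Proof. by rewrite /in_down_triangle; case: up; rewrite /= all_fset3 /=; lia. Qed.

Lemma B_region_cells x a b c : B_region x a b c
  = [fset tri d | d in B_cells x a b c].
Proof.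
apply/fsetP => -[[i j] up].
rewrite in_fset_sep in_halved_hexagon in_down_triangleE.
apply/idP/imfsetP => /= [h|[[r q]]].
  (* This column inverts [tri]. *)
  exists (`|j|%N, `|(2 * i + j + 2 + up%:R)%R|%N).
    by rewrite in_B_cells /in_B; case: up h => /= h; lia.
  rewrite /tri /=; congr (_, _, _); case: up h => /= h; lia.
rewrite in_B_cells /tri /= => B [-> -> ->]; move: B; rewrite /in_B.
have := odd_double_half (r + q); case: (odd (r + q)) => /=; lia.
Qed.

Lemma M_B_path_det (R : comRingType) x a b c :
  ((M (B_region x a b c))%:R)%R
  = path_det R (x + a) ([seq (2 * c, i.*2.+2) | i <- iota 0 a]
     ++ [seq (2 * a + 2 * c + b + 1, b + 1 + k.*2) | k <- iota 0 x]).
Proof.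
rewrite B_region_cells -/(cellM _).
set X := [seq b + 1 + k.*2 | k <- iota 0 x].
have mX q : (q \in X) = [&& b < q, odd (b + q) & q <= 2 * x + b].
  apply/mapP/and3P => [[k]|[bq oq qx]]; first by rewrite mem_iota => ? ->;
    split; lia.
  by exists (q - b)./2; rewrite ?mem_iota; lia.
(* B is the stage of its last row in which nothing is covered and all up-pointing cells, those along
   the southern side, are unpaired. *)
have -> : B_cells x a b c = stage x a b c (2 * a + 2 * c + b) [::] X.
  apply/fsetP => -[r q]; rewrite in_B_cells stageE /= mX ?in_nil.
  apply/esym/andb_idr; case: ifP => o; rewrite ?andbT; move: o; rewrite /in_B; lia.
rewrite (@cellM_rows x a b c R) //; first last.
- rewrite /waiting /notch ifT ?size_map ?size_iota.
  by rewrite addn0 addnC.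
  by clear; lia.
- apply/allP => q; rewrite mX /in_B; lia.
- rewrite /= /X pairwise_map -sorted_pairwise => [|i j k /=]; last by lia.
  by apply: (sub_sorted _ (iota_ltn_sorted 0 x)) => i j /=; lia.
- by rewrite addn1.
rewrite /waiting ifT; last by lia.
by rewrite /notch /X -!map_comp -[(2 * a + 2 * c + b).+1]addn1.
Qed.

(** For [a = 0] the removed triangle is empty; this is the boundary case settled by Proctor's
    theorem. *)
Lemma P_region_B x b c : P_region c.+1 (b + c) x = B_region x 0 b c.
Proof.
apply/fsetP => -[[i j] up].
rewrite /P_region in_fset_sep !in_halved_hexagon in_down_triangleE.
by case: up => /=; lia.
Qed.

Lemma M_P0 x : M (P_region 0 0 x) = 1.
Proof.
rewrite -cellM0 /cellM; congr M; apply/fsetP => -[[i j] up].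
rewrite in_halved_hexagon (_ : imfset _ _ _ = fset0) ?in_fset0; last first.
  by apply/fsetP => t; rewrite in_fset0; apply/imfsetP => -[].
by lia.
Qed.

Lemma M_P_path_det (R : comRingType) a c :
  ((M (P_region c c a))%:R)%R = path_det R a [seq (2 * c, i.*2.+2) | i <- iota 0 a].
Proof.
case: c => [|c]; first by rewrite M_P0 path_det_top.
(* Here [b = 1], and the southern heads get the columns 2, 4, ..., [2 a]. *)
rewrite -[X in P_region _ X _]/(1 + c) P_region_B M_B_path_det addn0 /=.
congr path_det; apply: eq_map => k; congr (_, _); lia.
Qed.

(** * Convolution of ballot numbers *)

Lemma sum_odd_even (F : nat -> nat) K :
  \sum_(q < K.*2.+1) F q = F 0 + \sum_(p < K) (F p.*2.+1 + F p.*2.+2).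
Proof.
elim: K => [|K IH]; first by rewrite big_ord1 big_ord0 addn0.
by rewrite doubleS 2!big_ord_recr /= IH big_ord_recr /= -!addnA.
Qed.

Lemma ballot_parity N q : ~~ odd (N + q) -> ballot N q = 0.
Proof.
elim: N q => [|N IH] [|q] //=; first by case: q => // -[].
by move=> h; rewrite !IH //; move: h; lia.
Qed.

(** A walk from 1 to 1 is cut after [N] steps, and its second part reversed; the bound on [K] admits
    every endpoint of that part. The induction moves one step from one factor to the other. *)
Lemma ballot_conv N N' K : N'.+1 < K -> \sum_(q < K) ballot N q * ballot N' q
  = ballot (N + N') 1.
Proof.
elim: N' N K => [|N' IH] N K NK.
  rewrite (bigD1 (Ordinal NK)) //= muln1 addn0 big1 ?addn0 // => q.
  by rewrite -val_eqE /= => /negPf->; rewrite muln0.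
rewrite addnS -addSn -(IH _ K); last exact: ltnW.
case: K NK => // K NK; rewrite !big_ord_recl /= !ballot_wall /= !muln0 !add0n.
rewrite /bump /=.
under eq_bigr do rewrite add1n /= mulnDr.
under [RHS]eq_bigr do rewrite add1n /= mulnDl.
rewrite !big_split /= addnC; congr (_ + _).
- case: K NK => // K NK; rewrite big_ord_recr big_ord_recl /= ballot_wall mul0n
    add0n.
  by rewrite (@ballot_far N' K.+2) ?muln0 ?addn0; [apply: eq_bigr | lia].
case: K NK => // K NK; rewrite big_ord_recl big_ord_recr /= ballot_wall muln0 add0n.
by rewrite (@ballot_far N' K.+1) ?muln0 ?addn0; [apply: eq_bigr | lia].
Qed.

(** An odd number of steps from 1 ends in an even column, so only these contribute. *)
Lemma ballot_conv_odd N j n : j < n ->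
  \sum_(p < n) ballot N p.*2.+2 * ballot j.*2.+1 p.*2.+2 = ballot (N + j.*2.+1) 1.
Proof.
move=> jn; rewrite -(@ballot_conv _ _ n.*2.+1); last by lia.
rewrite (sum_odd_even (fun q => ballot N q * ballot j.*2.+1 q)) !ballot_wall add0n.
by apply: eq_bigr => p _; rewrite (@ballot_parity j.*2.+1 p.*2.+1) ?muln0 //; lia.
Qed.

Local Open Scope ring_scope.

Ltac pos_neq0 := apply: lt0r_neq0; lra.
Ltac pos_field := field; do ?[apply/andP; split]; try pos_neq0.

(** * The Desnanot-Jacobi identity *)

Section Desnanot.
Variable F : fieldType.

Lemma det_Schur m n (E : 'M[F]_m) (C : 'M_(m, n)) (B : 'M_(n, m)) (A : 'M_n) :
  A \in unitmx -> \det (block_mx E C B A) = \det A * \det (E - C *m invmx A *m B).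
Proof.
move=> uA; have -> : block_mx E C B A =
    block_mx 1%:M (C *m invmx A) 0 1%:M *m block_mx (E - C *m invmx A *m B) 0 B A.
  by rewrite mulmx_block !mul1mx !mul0mx !add0r subrK mulmxKV.
by rewrite det_mulmx det_ublock !det1 det_lblock !mul1r mulrC.
Qed.

Lemma det_reindex n (s : 'S_n) (A : 'M[F]_n) :
  \det (\matrix_(i, j) A (s i) (s j)) = \det A.
Proof.
have -> : \matrix_(i, j) A (s i) (s j) = row_perm s (col_perm s A).
  by apply/matrixP => i j; rewrite !mxE.
rewrite row_permE col_permE !det_mulmx !det_perm odd_permV mulrC -mulrA.
by rewrite -signr_addb addbb mulr1.
Qed.

Lemma det2 (A : 'M[F]_2) :
  \det A = A ord0 ord0 * A ord_max ord_max - A ord0 ord_max * A ord_max ord0.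
Proof.
rewrite (expand_det_row _ ord0) !big_ord_recl big_ord0 /cofactor !det_mx11 !mxE /=.
rewrite expr0 expr1 mul1r mulN1r mulrN addr0.
by congr (_ * A _ _ - A _ _ * A _ _); apply: val_inj.
Qed.

Variable f : nat -> nat -> F.

Definition fdet (n r c : nat) : F := \det (\matrix_(i < n,
  j < n) f (r + i)%N (c + j)%N).

(** Taking Schur complements of the central block [A] turns each minor into [\det A] times a
    determinant of order 1 or 2 in the numbers [sg r c]; what remains is the formula for a
    determinant of order 2. *)
Lemma Desnanot_Jacobi n : fdet n 1 1 != 0 ->
  fdet n.+2 0 0 * fdet n 1 1
  = fdet n.+1 0 0 * fdet n.+1 1 1 - fdet n.+1 1 0 * fdet n.+1 0 1.
Proof.
set A : 'M[F]_n := \matrix_(i, j) f (1 + i)%N (1 + j)%N => dA.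
have uA : A \in unitmx by rewrite unitmxE unitfE.
pose row1 r : 'rV[F]_n := \row_j f r (1 + j)%N.
pose col1 c : 'cV[F]_n := \col_i f (1 + i)%N c.
pose sg r c := f r c - (row1 r *m invmx A *m col1 c) 0 0.
have bordered m (rho gam : 'I_m -> nat) (g h : 'I_(m + n) -> nat) :
    (forall i, g (lshift n i) = rho i) -> (forall i, h (lshift n i) = gam i) ->
    (forall i, g (rshift m i) = (1 + i)%N) -> (forall i, h (rshift m i)
      = (1 + i)%N) ->
    \det (\matrix_(i, j) f (g i) (h j)) = \det A * \det (\matrix_(i,
      j) sg (rho i) (gam j)).
  move=> g0 h0 gS hS.
  rewrite -[\matrix_(i, j) f _ _]submxK.
  rewrite (_ : drsubmx _ = A); last first.
    by apply/matrixP => i j; rewrite !mxE gS hS.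
  rewrite det_Schur //; congr (_ * \det _); apply/matrixP => i j.
  rewrite /sg !mxE g0 h0; congr (_ - _); apply: eq_bigr => k _.
  rewrite !mxE h0 gS; congr (_ * _); apply: eq_bigr => l _.
  by rewrite !mxE g0 hS.
have bordered1 r c (g h : 'I_n.+1 -> nat) :
    g ord0 = r -> h ord0 = c -> (forall i, g (lift ord0 i) = (1 + i)%N) ->
    (forall i, h (lift ord0 i) = (1 + i)%N) ->
    \det (\matrix_(i, j) f (g i) (h j)) = \det A * sg r c.
  move=> g0 h0 gS hS; rewrite (bordered 1%N (fun=> r) (fun=> c)) //.
  - by rewrite det_mx11 mxE.
  - by move=> i; rewrite -g0; congr g; apply: val_inj; rewrite /= ord1.
  - by move=> i; rewrite -h0; congr h; apply: val_inj; rewrite /= ord1.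
  - by move=> i; rewrite -gS; congr g; apply: val_inj.
  - by move=> i; rewrite -hS; congr h; apply: val_inj.
(* The permutations bring the border to the front; their signs cancel because
   each occurs twice in every product of minors. *)
pose s1 : 'S_n.+1 := lift_perm ord0 ord_max 1%g.
have s10 : s1 ord0 = ord_max by rewrite lift_perm_id.
have s1S i : s1 (lift ord0 i) = lift ord_max i by rewrite lift_perm_lift perm1.
have s1S' i : nat_of_ord (s1 (lift ord0 i)) = i
  by rewrite s1S /= /bump leqNgt ltn_ord.
pose s2 : 'S_n.+2 := lift_perm ord0 ord0 s1.
have e00 : fdet n.+1 0 0 = \det A * sg 0%N 0%N by apply: bordered1.
have e11 : fdet n.+1 1 1 = \det A * sg n.+1 n.+1.
  rewrite /fdet -(det_reindex s1) -(bordered1 _ _ (fun i => 1 + s1 i)%N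
    (fun i => 1 + s1 i)%N) //.
  - by congr (\det _); apply/matrixP => i j; rewrite !mxE.
  - by rewrite s10.
  - by rewrite s10.
  - by move=> i; rewrite s1S'.
  - by move=> i; rewrite s1S'.
have e10 : fdet n.+1 1 0 = (-1) ^+ s1 * (\det A * sg n.+1 0%N).
  rewrite -(bordered1 _ _ (fun i => 1 + s1 i)%N (fun i => i)) ?s10 //; last
    by move=> i; rewrite s1S'.
  have -> : \matrix_(i, j) f (1 + s1 i)%N j
    = row_perm s1 (\matrix_(i < n.+1, j < n.+1) f (1 + i)%N (0 + j)%N).
    by apply/matrixP => i j; rewrite !mxE.
  by rewrite row_permE det_mulmx det_perm mulrA -signr_addb addbb mul1r.
have e01 : fdet n.+1 0 1 = (-1) ^+ s1 * (\det A * sg 0%N n.+1).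
  rewrite -(bordered1 _ _ (fun i => i) (fun i => 1 + s1 i)%N) ?s10 //; last
    by move=> i; rewrite s1S'.
  have -> : \matrix_(i, j) f i (1 + s1 j)%N
    = col_perm s1 (\matrix_(i < n.+1, j < n.+1) f (0 + i)%N (1 + j)%N).
    by apply/matrixP => i j; rewrite !mxE.
  by rewrite col_permE det_mulmx det_perm odd_permV mulrCA -signr_addb addbb mulr1.
have e22 : fdet n.+2 0 0
    = \det A * (sg 0%N 0%N * sg n.+1 n.+1 - sg 0%N n.+1 * sg n.+1 0%N).
  rewrite /fdet -(det_reindex s2).
  pose rho (i : 'I_2) := if i == ord0 then 0%N else n.+1.
  have s20 (i : 'I_2) : nat_of_ord (s2 (lshift n i)) = rho i.
    rewrite /rho; case: i => [[|[|//]] h] /=.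
      rewrite (_ : @lshift 2 n _ = (ord0 : 'I_n.+2)); last exact: val_inj.
      by rewrite lift_perm_id.
    rewrite (_ : @lshift 2 n _ = (lift ord0 ord0 : 'I_n.+2)); last exact: val_inj.
    by rewrite lift_perm_lift s10.
  have s2S (i : 'I_n) : nat_of_ord (s2 (rshift 2 i)) = (1 + i)%N.
    rewrite (_ : rshift 2 i = (lift ord0 (lift ord0 i) : 'I_n.+2));
      last exact: val_inj.
    by rewrite lift_perm_lift s1S /= /bump /= [(n <= i)%N]leqNgt ltn_ord.
  transitivity (\det (\matrix_(i < 2 + n, j < 2 + n) f (s2 i) (s2 j))).
    by congr (\det _); apply/matrixP => i j; rewrite !mxE.
  rewrite (bordered 2%N rho rho (fun i => s2 i) (fun i => s2 i)) //.
  by rewrite det2 !mxE.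
rewrite e00 e11 e10 e01 e22 -/A.
have : (-1) ^+ s1 * (-1) ^+ s1 = 1 :> F by rewrite -signr_addb addbb.
rewrite /fdet -/A; move: ((-1) ^+ s1) => e ee.
have -> : e * (\det A * sg n.+1 0%N) * (e * (\det A * sg 0%N n.+1))
  = (e * e) * (\det A * sg n.+1 0%N * (\det A * sg 0%N n.+1)) by ring.
by rewrite ee; ring.
Qed.
End Desnanot.

(** * The two families of determinants and their recurrences *)

Section Families.
Variable R : realFieldType.

(** Row [i] is a starting edge and column [k] a head in column [b + 1 + 2 k] at level [2 c + b - 1].
    Deleting the first row raises [c] by 1; deleting the first column turns [(b, c)] into
    [(b + 2, c - 1)]. *)
Definition proctor_entry (b c i k : nat) : R :=
  (ballot (2 * i + 2 * c + b) (b + 1 + 2 * k))%:R.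

Definition proctor_det (x b c : nat) : R := fdet (proctor_entry b c) x 0 0.

(** The first [a] columns form a Hankel matrix of Catalan numbers. Deleting the first row raises [c]
    by 1; deleting the first column, for positive [a], lowers [a] and raises [c] by 1. *)
Definition notch_entry (a b c i j : nat) : R :=
  if (j < a)%N then (ballot (2 * (c + i + j) + 2) 1)%:R
  else (ballot (2 * (a + c + i) + b + 2) (b + 1 + 2 * (j - a)))%:R.

Definition notch_det (n a b c : nat) : R := fdet (notch_entry a b c) n 0 0.

Lemma eq_fdet (f g : nat -> nat -> R) n r c :
  (forall i j, f (r + i)%N (c + j)%N = g i j) -> fdet f n r c = fdet g n 0 0.
Proof. by move=> fg; congr (\det _); apply/matrixP => i j; rewrite !mxE fg. Qed.

Lemma proctor_det_rec x b c : proctor_det x b.+2 c.+1 != 0 ->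
  proctor_det x.+2 b c.+1 * proctor_det x b.+2 c.+1
  = proctor_det x.+1 b c.+1 * proctor_det x.+1 b.+2 c.+1
    - proctor_det x.+1 b c.+2 * proctor_det x.+1 b.+2 c.
Proof.
have e11 n : fdet (proctor_entry b c.+1) n 1 1 = proctor_det n b.+2 c.+1.
  by apply: eq_fdet => i j; congr (ballot _ _)%:R; lia.
have e10 n : fdet (proctor_entry b c.+1) n 1 0 = proctor_det n b c.+2.
  by apply: eq_fdet => i j; congr (ballot _ _)%:R; lia.
have e01 n : fdet (proctor_entry b c.+1) n 0 1 = proctor_det n b.+2 c.
  by apply: eq_fdet => i j; congr (ballot _ _)%:R; lia.
by rewrite -!e11 -e10 -e01; apply: Desnanot_Jacobi.
Qed.

Lemma notch_det_rec n a b c : notch_det n a b c.+2 != 0 ->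
  notch_det n.+2 a.+1 b c * notch_det n a b c.+2
  = notch_det n.+1 a.+1 b c * notch_det n.+1 a b c.+2
    - notch_det n.+1 a.+1 b c.+1 * notch_det n.+1 a b c.+1.
Proof.
have e11 m : fdet (notch_entry a.+1 b c) m 1 1 = notch_det m a b c.+2.
  by apply: eq_fdet => i j; rewrite /notch_entry ltnS; case: ifP => _;
    congr (ballot _ _)%:R; lia.
have e10 m : fdet (notch_entry a.+1 b c) m 1 0 = notch_det m a.+1 b c.+1.
  by apply: eq_fdet => i j; rewrite /notch_entry add0n; case: ifP => _;
    congr (ballot _ _)%:R; lia.
have e01 m : fdet (notch_entry a.+1 b c) m 0 1 = notch_det m a b c.+1.
  by apply: eq_fdet => i j; rewrite /notch_entry ltnS; case: ifP => _;
    congr (ballot _ _)%:R; lia.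
by rewrite -!e11 -e10 -e01; apply: Desnanot_Jacobi.
Qed.

Lemma proctor_det_c0 x b : proctor_det x b 0 = 1.
Proof.
rewrite /proctor_det /fdet det_trig.
  by rewrite big1 // => i _; rewrite mxE /proctor_entry (_ : b + 1 + _
    = (2 * (0 + i) + 2 * 0 + b).+1)%N ?ballot_top //; lia.
by apply/is_trig_mxP => i j ij; rewrite mxE /proctor_entry ballot_far //; lia.
Qed.

Lemma proctor_det_0 b c : proctor_det 0 b c = 1. Proof. exact: det_mx00. Qed.

Lemma proctor_det_1 b c : proctor_det 1 b c = (ballot (2 * c + b) b.+1)%:R.
Proof. by rewrite /proctor_det /fdet det_mx11 mxE /proctor_entry /= ?addn0
  ?add0n; congr (ballot _ _)%:R; lia. Qed.

Lemma notch_det_a0 n b c : notch_det n 0 b c = proctor_det n b c.+1.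
Proof. by apply: eq_fdet => i j; rewrite /notch_entry /proctor_entry;
  congr (ballot _ _)%:R; lia. Qed.

Lemma M_P_proctor_det a c : (M (P_region c c a))%:R = proctor_det a 1 c.
Proof.
rewrite M_P_path_det /path_det -det_tr; congr (\det _); apply/matrixP => i j.
rewrite !mxE (nth_map 0%N) ?size_iota // nth_iota //=.
by congr (ballot _ _)%:R; lia.
Qed.

Lemma M_B_notch_det x a b c : (M (B_region x a b c))%:R = notch_det (x + a) a b c.
Proof.
rewrite M_B_path_det /path_det -det_tr; set hs := _ ++ _.
(* Multiplication by U moves the notch heads from level 2 c to the edges q = 1 on
   the line l, which makes their columns Catalan numbers. *)
pose U : 'M[R]_(x + a) := \matrix_(p, j)
  if (j < a)%N then (ballot j.*2.+1 p.*2.+2)%:R else (p == j)%:R.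
have dU : \det U = 1.
  rewrite -det_tr det_trig.
    rewrite big1 // => i _; rewrite !mxE eqxx; case: ifP => // _;
      by rewrite ballot_top.
  apply/is_trig_mxP => i j ij; rewrite !mxE; case: ifP => _; first
    by rewrite ballot_far //; lia.
  by rewrite -val_eqE /= gtn_eqF.
rewrite -[LHS]mulr1 -[X in _ * X = _]dU -det_mulmx; congr (\det _);
  apply/matrixP => i j.
have nthW (p : nat) : (p < a)%N -> nth (0, 0)%N hs p = (2 * c, p.*2.+2)%N.
  move=> pa; rewrite nth_cat size_map size_iota pa (nth_map 0%N) ?size_iota //.
  by rewrite nth_iota.
rewrite !mxE /notch_entry !add0n; case: ifP => ja.
  rewrite (_ : 2 * (c + i + j) + 2 = 2 * c + i.*2 + 1 + j.*2.+1)%N; last by lia.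
  rewrite -(@ballot_conv_odd _ j (x + a)) // natr_sum; apply: eq_bigr => p _.
  rewrite !mxE ja natrM; case: (ltnP p a) => pa; first by rewrite nthW.
  by rewrite (@ballot_far j.*2.+1) ?mulr0 //; lia.
rewrite (bigD1 j) //= big1 => [|p /negPf pj]; last by rewrite !mxE ja pj mulr0.
rewrite !mxE ja eqxx mulr1 addr0 nth_cat size_map size_iota ja.
have jx : (j - a < x)%N by have := ltn_ord j; lia.
rewrite (nth_map 0%N) ?size_iota // nth_iota //.
by congr (ballot _ _)%:R; rewrite /=; lia.
Qed.

Lemma notch_det_x0 a b c : notch_det a a b c = proctor_det a 1 c.
Proof. by rewrite -[X in notch_det X]add0n -M_B_notch_det -M_P_proctor_det
  M_B_path_det M_P_path_det cats0. Qed.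

(** * Proctor's product formula *)

(* proctor_ratio y b c is proctor_det (y + 1) b c / proctor_det y b c. *)
Definition proctor_factor (y i b : R) : R :=
  (y + i + 1 + b) * (2 * y + b + 2 * i + 1) * (2 * y + b + 2 * i + 2)
  / ((y + i + 1) * (2 * y + b + i + 1) * (2 * y + b + i + 2)).

Definition proctor_ratio (y : R) (b c : nat) : R :=
  \prod_(i < c) proctor_factor y i%:R b%:R.
Definition proctor_prod (x b c : nat) : R := \prod_(y < x) proctor_ratio y%:R b c.

Lemma proctor_ratioS y b c : proctor_ratio y b c.+1
  = proctor_ratio y b c * proctor_factor y c%:R b%:R.
Proof. by rewrite /proctor_ratio big_ord_recr. Qed.

Lemma proctor_prodS x b c : proctor_prod x.+1 b c
  = proctor_prod x b c * proctor_ratio x%:R b c.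
Proof. by rewrite /proctor_prod big_ord_recr. Qed.

Lemma proctor_factor_gt0 y i b : 0 <= y -> 0 <= i -> 0 <= b
  -> 0 < proctor_factor y i b.
Proof. by move=> y0 i0 b0; rewrite divr_gt0 // !mulr_gt0 //; lra. Qed.

Lemma proctor_ratio_gt0 y b c : 0 <= y -> 0 < proctor_ratio y b c.
Proof. by move=> y0; apply: prodr_gt0 => i _; apply: proctor_factor_gt0. Qed.

Lemma proctor_prod_gt0 x b c : 0 < proctor_prod x b c.
Proof. by apply: prodr_gt0 => i _; apply: proctor_ratio_gt0. Qed.

Lemma proctor_ratio_shift y b c : 0 <= y ->
  proctor_ratio (y + 1) b c = proctor_ratio y b.+2 c * ((y + 1) * (y + b%:R + 2)
    / ((y + c%:R + 1) * (y + c%:R + b%:R + 2))).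
Proof.
move=> y0; have b0 := ler0n R b; elim: c => [|c IH].
  by rewrite /proctor_ratio !big_ord0; pos_field.
rewrite !proctor_ratioS IH -!natr1 /proctor_factor; have c0 := ler0n R c; pos_field.
Qed.

(** Used at [x.+1], this makes the subtracted term of the recurrence a rational multiple of the term
    before it. *)
Lemma proctor_prod_cross x b c :
  proctor_prod x b c.+2 * proctor_prod x b.+2 c
    = proctor_prod x b c.+1 * proctor_prod x b.+2 c.+1
  * ((c%:R + 1) * (2 * x%:R + b%:R + c%:R + 2) / ((x%:R + c%:R + 1) * (x%:R +
    c%:R + b%:R + 2))).
Proof.
have b0 := ler0n R b; have c0 := ler0n R c; elim: x => [|x IH].
  by rewrite /proctor_prod !big_ord0; pos_field.
have x0 := ler0n R x.
rewrite !proctor_prodS mulrACA IH proctor_ratioS (proctor_ratioS _ b.+2) -!natr1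
  /proctor_factor; pos_field.
Qed.

Lemma proctor_prod_rec x b c :
  proctor_prod x.+2 b c.+1 * proctor_prod x b.+2 c.+1
  = proctor_prod x.+1 b c.+1 * proctor_prod x.+1 b.+2 c.+1
    - proctor_prod x.+1 b c.+2 * proctor_prod x.+1 b.+2 c.
Proof.
rewrite proctor_prod_cross proctor_prodS (proctor_prodS x b.+2) -natr1
  proctor_ratio_shift // -!natr1.
have b0 := ler0n R b; have c0 := ler0n R c; have x0 := ler0n R x; pos_field.
Qed.

Lemma proctor_ratio0_shift b c :
  proctor_ratio 0 b.+1 c = proctor_ratio 0 b c * ((b%:R + 2) * (2 * c%:R + b%:R
    + 1) / ((b%:R + 1) * (b%:R + c%:R + 2))).
Proof.
have b0 := ler0n R b; elim: c => [|c IH].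
  by rewrite /proctor_ratio !big_ord0; pos_field.
rewrite !proctor_ratioS IH -!natr1 /proctor_factor; have c0 := ler0n R c; pos_field.
Qed.

(** The closed form of the ballot numbers, by the walk recurrence in [c] and [b]; it gives the
    initial value [x = 1]. *)
Lemma ballot_proctor_ratio b c : (ballot (2 * c + b) b.+1)%:R = proctor_ratio 0 b c.
Proof.
elim: c b => [|c IH] b; first by rewrite ballot_top /proctor_ratio big_ord0.
have c0 := ler0n R c; elim: b => [|b IHb].
  rewrite (_ : 2 * c.+1 + 0 = (2 * c + 1).+1)%N; last by lia.
  by rewrite ballotS ballot_wall add0n IH proctor_ratio0_shift proctor_ratioS
    /proctor_factor; pos_field.
have b0 := ler0n R b.
rewrite (_ : 2 * c.+1 + b.+1 = (2 * c.+1 + b).+1)%N; last by lia.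
rewrite ballotS natrD IHb (_ : 2 * c.+1 + b = 2 * c + b.+2)%N; last by lia.
by rewrite IH !proctor_ratio0_shift proctor_ratioS -!natr1 /proctor_factor;
  pos_field.
Qed.

(** The recurrence links [x], [x.+1] and [x.+2], so two consecutive values are carried along;
    positivity of the product permits the division. *)
Lemma proctor_detE x b c : proctor_det x b c = proctor_prod x b c.
Proof.
move: x b c; suff: forall x, (forall b c, proctor_det x b c
  = proctor_prod x b c) /\ (forall b c, proctor_det x.+1 b c
  = proctor_prod x.+1 b c).
  by move=> h x b c; have [] := h x.
elim=> [|x [IH0 IH1]]; split=> // b c.
- by rewrite proctor_det_0 /proctor_prod big_ord0.
- by rewrite proctor_det_1 /proctor_prod big_ord1 ballot_proctor_ratio.
case: c => [|c]; first by rewrite proctor_det_c0 /proctor_prod big1 // => y _;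
  rewrite /proctor_ratio big_ord0.
have nz : proctor_det x b.+2 c.+1 != 0 by rewrite IH0 lt0r_neq0 ?proctor_prod_gt0.
by apply: (mulIf nz); rewrite proctor_det_rec // !IH0 !IH1 proctor_prod_rec.
Qed.

(** * The product formula for B and its recurrence *)

Definition west_ratio (s : R) (c : nat) : R :=
  \prod_(l < c) ((s + 2 * l%:R + 1) * (s + 2 * l%:R + 2) / ((s + l%:R) * (s +
    l%:R + 1))).

Definition southwest_ratio (y w : R) (b : nat) : R :=
  \prod_(i < b) ((w + 1 + i%:R) / (y + 1 + i%:R)).

(** The growth factor of the number of tilings when [x] passes from [y] to [y + 1]. *)
Definition notch_ratio (y : R) (a b c : nat) : R :=
  southwest_ratio y (y + 2 * a%:R + c%:R + 1) b * west_ratio (2 * y + 2 * a%:R +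
    b%:R + 2) c.

Definition notch_prod (x a b c : nat) : R :=
  proctor_prod a 1 c * \prod_(y < x) notch_ratio y%:R a b c.

Lemma west_ratioS s c : west_ratio s c.+1 = west_ratio s c *
  ((s + 2 * c%:R + 1) * (s + 2 * c%:R + 2) / ((s + c%:R) * (s + c%:R + 1))).
Proof. by rewrite /west_ratio big_ord_recr. Qed.

(** Raising [s] by 2 shifts the numerators by one index and the denominators by two, so the quotient
    telescopes. *)
Lemma west_ratio_shift1 s c : 0 < s -> west_ratio s c.+1 = west_ratio (s + 2) c *
  ((s + c%:R + 2) * (s + c%:R + 1) / (s * (s + 1))).
Proof.
move=> s0; elim: c => [|c IH].
  by rewrite /west_ratio big_ord1 big_ord0 /=; pos_field.
by rewrite west_ratioS IH west_ratioS -!natr1; have c0 := ler0n R c; pos_field.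
Qed.

Lemma west_ratio_shift2 s c : 0 < s -> west_ratio s c.+2 = west_ratio (s + 2) c *
  ((s + 2 * c%:R + 4) * (s + 2 * c%:R + 3) / (s * (s + 1))).
Proof.
move=> s0; rewrite west_ratioS west_ratio_shift1 // -!natr1.
have c0 := ler0n R c; pos_field.
Qed.

Lemma southwest_ratio_shift y w b : 0 <= y -> 0 <= w ->
  southwest_ratio y (w + 1) b = southwest_ratio y w b * ((w + b%:R + 1) / (w + 1)).
Proof.
move=> y0 w0; rewrite /southwest_ratio; elim: b => [|b IH]; first
  by rewrite !big_ord0; pos_field.
by rewrite !big_ord_recr /= IH -natr1; have b0 := ler0n R b; pos_field.
Qed.

Lemma notch_ratio_gt0 y a b c : 0 <= y -> 0 < notch_ratio y a b c.
Proof.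
move=> y0; have a0 := ler0n R a; have b0 := ler0n R b; have c0 := ler0n R c.
apply: mulr_gt0; apply: prodr_gt0 => i _; have i0 := ler0n R i.
  by rewrite divr_gt0 //; lra.
by rewrite divr_gt0 // mulr_gt0 //; lra.
Qed.

Lemma notch_prod_gt0 x a b c : 0 < notch_prod x a b c.
Proof. by rewrite mulr_gt0 ?proctor_prod_gt0 // prodr_gt0 // => y _;
  rewrite notch_ratio_gt0. Qed.

Lemma notch_prodS x a b c : notch_prod x.+1 a b c
  = notch_prod x a b c * notch_ratio x%:R a b c.
Proof. by rewrite /notch_prod big_ord_recr /= mulrA. Qed.

(** The growth factors agree for [a = 0], as the base of the final induction requires. *)
Lemma proctor_ratio_notch (y : R) b c : 0 <= y -> proctor_ratio y b c.+1
  = notch_ratio y 0 b c.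
Proof.
move=> y0; have b0 := ler0n R b; rewrite /notch_ratio mulr0 !addr0;
  elim: c => [|c IH].
  rewrite proctor_ratioS /proctor_ratio big_ord0 /west_ratio big_ord0 addr0
    mul1r mulr1 /proctor_factor /southwest_ratio.
  transitivity ((y + 1 + b%:R) / (y + 1)); first by pos_field.
  elim: b {b0} => [|b IH]; first by rewrite big_ord0; pos_field.
  by rewrite big_ord_recr /= -IH -natr1; have b0 := ler0n R b; pos_field.
have c0 := ler0n R c.
rewrite proctor_ratioS IH west_ratioS -[c.+1%:R]natr1 (_ : y + (c%:R + 1) + 1
  = y + c%:R + 1 + 1); last by rewrite !addrA.
by rewrite (southwest_ratio_shift (w := y + c%:R + 1)) //;
  [rewrite /proctor_factor; pos_field | lra].
Qed.

(** All growth factors in the recurrence are rational multiples of one product [P], which therefore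
    cancels. *)
Lemma notch_ratio_shifts (y : R) a b c : 0 <= y ->
  let v := y + 2 * a%:R + c%:R + 2 in let t := 2 * y + 2 * a%:R + b%:R + 2 in
  let P := southwest_ratio y v b * west_ratio (t + 2) c in
  [/\ notch_ratio y a b c.+1 = P * ((t + c%:R + 2) * (t + c%:R + 1) / (t * (t +
    1))),
      notch_ratio y a.+1 b c = P * ((v + b%:R + 1) / (v + 1)),
      notch_ratio y a b c.+2 = P * ((v + b%:R + 1) / (v + 1))
        * ((t + 2 * c%:R + 4) * (t + 2 * c%:R + 3) / (t * (t + 1))) &
      notch_ratio y a.+1 b c.+1 = P * ((v + b%:R + 1) / (v + 1)) * ((v + b%:R +
        2) / (v + 2))
        * ((t + 2 * c%:R + 3) * (t + 2 * c%:R + 4) / ((t + c%:R + 2) * (t + c%:R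
          + 3)))].
Proof.
move=> y0 v t P.
have a0 := ler0n R a; have b0 := ler0n R b; have c0 := ler0n R c.
have v0 : 0 <= v by rewrite /v; lra.
have t0 : 0 < t by rewrite /t; lra.
have es : 2 * y + 2 * a.+1%:R + b%:R + 2 = t + 2 by rewrite /t -natr1; ring.
split; rewrite /notch_ratio -/t ?es.
- rewrite (_ : y + 2 * a%:R + c.+1%:R + 1 = v) ?west_ratio_shift1 ?mulrA //.
  by rewrite /v -natr1; ring.
- rewrite (_ : y + 2 * a.+1%:R + c%:R + 1 = v + 1) ?southwest_ratio_shift //;
    last by rewrite /v -natr1; ring.
  by rewrite /P; ring.
- rewrite (_ : y + 2 * a%:R + c.+2%:R + 1 = v + 1) ?southwest_ratio_shift //;
    last by rewrite /v -!natr1; ring.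
  by rewrite west_ratio_shift2 // /P; ring.
- rewrite (_ : y + 2 * a.+1%:R + c.+1%:R + 1 = v + 1 + 1); last
    by rewrite /v -!natr1; ring.
  have v1 : 0 <= v + 1 by rewrite addr_ge0.
  rewrite southwest_ratio_shift // southwest_ratio_shift // west_ratioS /P.
  have -> : v + 1 + b%:R + 1 = v + b%:R + 2 by ring.
  have -> : v + 1 + 1 = v + 2 by ring.
  have -> : t + 2 + 2 * c%:R + 1 = t + 2 * c%:R + 3 by ring.
  have -> : t + 2 + 2 * c%:R + 2 = t + 2 * c%:R + 4 by ring.
  have -> : t + 2 + c%:R + 1 = t + c%:R + 3 by ring.
  have -> : t + 2 + c%:R = t + c%:R + 2 by ring.
  by ring.
Qed.

Lemma proctor_prod_cross1 a c :
  proctor_prod a.+1 1 c.+1 * proctor_prod a 1 c.+1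
  = proctor_prod a.+1 1 c * proctor_prod a 1 c.+2 * (2 * (2 * c%:R + 3) / (2 *
    a%:R + c%:R + 3)).
Proof.
have c0 := ler0n R c; elim: a => [|a IH].
  by rewrite !proctor_prodS /proctor_prod !big_ord0 proctor_ratioS
    /proctor_factor; pos_field.
have a0 := ler0n R a.
rewrite (proctor_prodS a.+1) [X in _ * X = _]proctor_prodS mulrACA IH.
rewrite (proctor_prodS a.+1) (proctor_prodS a 1 c.+2) !proctor_ratioS.
by rewrite /proctor_factor -!natr1; pos_field.
Qed.

(** As for Proctor's product, this reduces the subtracted term of the recurrence to the products in
    its other terms. *)
Lemma notch_prod_cross x a b c :
  notch_prod x a.+1 b c.+1 * notch_prod x a b c.+1
  = notch_prod x a.+1 b c * notch_prod x a b c.+2 * (2 * (2 * c%:R + 3) * (x%:R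
    + 2 * a%:R + c%:R + 3 + b%:R)
     / ((x%:R + 2 * a%:R + c%:R + 3) * (2 * x%:R + 2 * a%:R + b%:R + c%:R + 3))).
Proof.
have a0 := ler0n R a; have b0 := ler0n R b; have c0 := ler0n R c;
  elim: x => [|x IH].
  by rewrite /notch_prod !big_ord0 !mulr1 proctor_prod_cross1; pos_field.
have x0 := ler0n R x.
have [e1 e2 e3 e4] := notch_ratio_shifts a b c x0.
rewrite !notch_prodS mulrACA IH e1 e2 e3 e4 -[x.+1%:R]natr1.
move: (southwest_ratio _ _ _ * west_ratio _ _) (notch_prod _ _ _ _) (notch_prod
  _ _ _ _) => P U V; pos_field.
Qed.

Lemma notch_prod_rec x a b c :
  notch_prod x.+1 a.+1 b c * notch_prod x a b c.+2
  = notch_prod x a.+1 b c * notch_prod x.+1 a b c.+2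
    - notch_prod x a.+1 b c.+1 * notch_prod x.+1 a b c.+1.
Proof.
have a0 := ler0n R a; have b0 := ler0n R b; have c0 := ler0n R c.
have x0 := ler0n R x.
rewrite !notch_prodS [X in _ - X]mulrA notch_prod_cross.
have [-> -> -> _] := notch_ratio_shifts a b c x0.
move: (southwest_ratio _ _ _ * west_ratio _ _) (notch_prod _ _ _ _) (notch_prod
  _ _ _ _) => P U V; pos_field.
Qed.

(** Induction on the order [x + a]: the recurrence reaches orders lower by 1 and 2, but with larger
    [c], so [c] stays general. *)
Lemma notch_detE x a b c : notch_det (x + a) a b c = notch_prod x a b c.
Proof.
move en : (x + a)%N => n; elim/ltn_ind: n => n IH in x a c en *.
case: a en => [|a] en.
  rewrite notch_det_a0 proctor_detE /notch_prod /proctor_prod [X in _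
    = X * _]big_ord0 mul1r -en addn0.
  by apply: eq_bigr => y _; rewrite proctor_ratio_notch.
case: x en => [|x] en.
  by rewrite -en add0n notch_det_x0 proctor_detE /notch_prod big_ord0 mulr1.
have IH' x' a' c' : (x' + a' < n)%N -> notch_det (x' + a') a' b c'
  = notch_prod x' a' b c'.
  by move=> h; apply: IH h _ _ _ erefl.
have nz : notch_det (x + a) a b c.+2 != 0
  by rewrite IH' ?lt0r_neq0 ?notch_prod_gt0 //; lia.
have en' : n = (x + a).+2 by lia.
have g0 : notch_det (x + a) a b c.+2 = notch_prod x a b c.+2 by apply: IH'; lia.
have g1 c' : notch_det (x + a).+1 a.+1 b c' = notch_prod x a.+1 b c'
  by rewrite -addnS IH' //; lia.
have g2 c' : notch_det (x + a).+1 a b c' = notch_prod x.+1 a b c'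
  by rewrite -addSn IH' //; lia.
by apply: (mulIf nz); rewrite en' notch_det_rec // !g1 !g2 g0 notch_prod_rec.
Qed.

(** * Quotients of T and V as telescoping products *)

(* poch and poch2 are the cases h = 1 and h = 2. *)
Definition step_poch (h z : R) (n : int) : R :=
  match n with
  | Posz k => \prod_(i < k) (z + h * i%:R)
  | Negz k => (\prod_(i < k.+1) (z - h * i.+1%:R))^-1
  end.

Definition stepT (h z : R) (n : int) (m : nat) : R :=
  \prod_(i < m) step_poch h (z + h * i%:R) (n - 2 * i%:Z).

Lemma Tprod_stepT z n m : Tprod z n (Posz m) = stepT 1 z n m.
Proof.
apply: eq_bigr => i _; rewrite mul1r /poch /step_poch; case: (n - _)%R => k.
  by apply: eq_bigr => j _; rewrite mul1r.
by congr (_^-1); apply: eq_bigr => j _; rewrite mul1r.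
Qed.

Lemma Vprod_stepT z n m : Vprod z n (Posz m) = stepT 2 z n m.
Proof. by []. Qed.

Lemma step_poch_gt0 h z n : 0 < h -> 0 < z -> 0 < z + h * n%:~R
  -> 0 < step_poch h z n.
Proof.
move=> h0 z0; case: n => k zn /=.
  by apply: prodr_gt0 => i _; rewrite ltr_wpDr // mulr_ge0 // ltW.
rewrite invr_gt0; apply: prodr_gt0 => i _; apply: (lt_le_trans zn).
rewrite NegzE mulrNz mulrN lerD2l lerN2 ler_pM2l // ler_nat.
exact: ltn_ord.
Qed.

(** Telescoping for either sign of [n]: the factor [z] leaves and [z + h n] enters. *)
Lemma step_poch_step h z n : 0 < h -> 0 < z -> 0 < z + h * n%:~R ->
  step_poch h (z + h) n = step_poch h z n * ((z + h * n%:~R) / z).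
Proof.
move=> h0 z0 zn; have nz := lt0r_neq0 z0.
case: n zn => k zn /=.
  rewrite -pmulrn; apply: (mulIf nz); rewrite mulrA divfK //.
  elim: k {zn} => [|k IH]; first by rewrite !big_ord0 mulr0 addr0.
  by rewrite !big_ord_recr /= mulrAC IH -natr1; ring.
have e j : \prod_(i < j) (z + h - h * i.+1%:R) * (z - h * j%:R)
           = z * \prod_(i < j) (z - h * i.+1%:R).
  elim: j => [|j IH]; first by rewrite !big_ord0; ring.
  rewrite !big_ord_recr /= mulrA -IH -natr1; ring.
have p0 := step_poch_gt0 h0 z0 zn; rewrite /= invr_gt0 in p0.
have zn' : z - h * k.+1%:R != 0.
  by move: zn; rewrite NegzE mulrNz mulrN => /lt0r_neq0.
have := e k.+1; rewrite NegzE mulrNz mulrN -pmulrn.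
move: (\prod_(i < _) (z + h - _)) (\prod_(i < _) (z - _)) p0 => A B B0 AB.
have nB := lt0r_neq0 B0.
have -> : A = z * B / (z - h * k.+1%:R) by rewrite -AB mulfK.
by rewrite invf_div invfM; field; rewrite nB nz.
Qed.

Section Ratio.
Variables (h : R) (n : int) (m : nat).
Hypothesis h0 : 0 < h.

(** The [i]-th factor starts at [z + h i] and has length [n - 2 i], so [z + h (n - i)] is its far
    end. *)
Lemma stepT_gt0 z : 0 < z -> (forall i, (i < m)%N -> 0 < z + h * (n%:~R - i%:R)) ->
  0 < stepT h z n m.
Proof.
move=> z0 zn; apply: prodr_gt0 => i _; apply: step_poch_gt0 => //.
  by rewrite ltr_wpDr // mulr_ge0 // ltW.
by have := zn _ (ltn_ord i); rewrite intrB rmorphM /=; lra.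
Qed.

Lemma stepT_step z : 0 < z -> (forall i, (i < m)%N -> 0 < z + h * (n%:~R - i%:R)) ->
  stepT h (z + h) n m
  = stepT h z n m * \prod_(i < m) ((z + h * (n%:~R - i%:R)) / (z + h * i%:R)).
Proof.
move=> z0 zn; rewrite /stepT -big_split; apply: eq_bigr => i _ /=.
have zi : 0 < z + h * i%:R by rewrite ltr_wpDr // mulr_ge0 // ltW.
have e : z + h * i%:R + h * (n - 2 * i%:Z)%:~R = z + h * (n%:~R - i%:R).
  by rewrite intrB rmorphM /=; ring.
rewrite addrAC step_poch_step ?e //; exact: zn.
Qed.

Lemma stepT_ratio x z :
  0 < z -> (forall i, (i < m)%N -> 0 < z + h * (n%:~R - i%:R)) ->
  stepT h (z + h * x%:R) n m / stepT h z n m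
  = \prod_(y < x) \prod_(i < m)
      ((z + h * y%:R + h * (n%:~R - i%:R)) / (z + h * y%:R + h * i%:R)).
Proof.
move=> z0 zn; have T0 := lt0r_neq0 (stepT_gt0 z0 zn).
elim: x => [|x IH]; first by rewrite mulr0 addr0 divff // big_ord0.
rewrite big_ord_recr /= -IH -natr1 mulrDr mulr1 addrA stepT_step; first
  by rewrite mulrAC.
  by rewrite ltr_wpDr // mulr_ge0 // ltW.
by move=> i im; rewrite addrAC ltr_wpDr ?zn // mulr_ge0 // ltW.
Qed.
End Ratio.

(** The factor [i = 0] is the quotient in [west_ratio_shift2], and the others belong to [s + 2] and
    [c - 2]; hence an induction by steps of 2. *)
Lemma west_ratio_pairs (s : R) c : 0 < s ->
  \prod_(i < (c + 1) %/ 2) ((s + 2 * c%:R - 2 * i%:R) / (s + 2 * i%:R)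
     * ((s + 2 * c%:R - 1 - 2 * i%:R) / (s + 1 + 2 * i%:R))) = west_ratio s c.
Proof.
have [k ck] := ubnP c; elim: k => // k IH in c s ck *; move=> s0.
case: c ck => [|[|c]] ck; first by rewrite /west_ratio !big_ord0.
  by rewrite /west_ratio !big_ord1 /=; pos_field.
rewrite west_ratio_shift2 // -IH; [|lia|lra].
rewrite (_ : (c.+2 + 1) %/ 2 = ((c + 1) %/ 2).+1)%N; last by lia.
rewrite big_ord_recl mulrC /=; congr (_ * _).
  apply: eq_bigr => i _; rewrite /bump /= add1n -[c.+2%:R]natr1 -[c.+1%:R]natr1
    -[i.+1%:R]natr1.
  by congr (_ / _ * (_ / _)); ring.
rewrite -[c.+2%:R]natr1 -[c.+1%:R]natr1; have c0 := ler0n R c; pos_field.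
Qed.

Lemma southwest_ratio_rev (y : R) a b c :
  \prod_(i < b) ((1 + y + ((2 * a + b + c)%N%:R - i%:R)) / (1 + y + i%:R))
  = southwest_ratio y (y + 2 * a%:R + c%:R + 1) b.
Proof.
rewrite 2!natrD natrM /southwest_ratio !prodf_div; congr (_ / _); last first.
  by apply: eq_bigr => i _; rewrite (addrC 1).
rewrite (reindex_inj rev_ord_inj); apply: eq_bigr => i _ /=.
by rewrite natrB // -[i.+1%:R]natr1; ring.
Qed.

Lemma T1_ratio x a b c :
  Tprod (x%:R + 1 : R) (2 * a + b + c)%N%:Z b%:Z / Tprod (1 : R) (2 * a + b +
    c)%N%:Z b%:Z
  = \prod_(y < x) southwest_ratio y%:R (y%:R + 2 * a%:R + c%:R + 1) b.
Proof.
rewrite !Tprod_stepT (addrC x%:R) -[x%:R]mul1r stepT_ratio //.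
  apply: eq_bigr => y _; rewrite -southwest_ratio_rev; apply: eq_bigr => i _.
  by rewrite !mul1r -pmulrn.
move=> i ib; rewrite mul1r -pmulrn -natrB; last by lia.
by rewrite ltr_wpDr.
Qed.

Section Parity.
Variables x a b c : nat.
Let m := ((c + 1) %/ 2)%N.

(** The bound [c - 1 <= n] serves both parities of [b]: every [i < m] is at most [c - 1], so all
    factors are positive. *)
Lemma V_ratio (z : R) (n : int) : 0 < z -> (c%:Z - 1 <= n) ->
  Vprod (2 * x%:R + z) n m / Vprod z n m
  = \prod_(y < x) \prod_(i < m)
      ((z + 2 * y%:R + 2 * (n%:~R - i%:R)) / (z + 2 * y%:R + 2 * i%:R)).
Proof.
move=> z0 cn; rewrite !Vprod_stepT (addrC (2 * _)) stepT_ratio // => i im.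
rewrite ltr_wpDr // mulr_ge0 // subr_ge0 pmulrn ler_int.
by apply: le_trans cn; move: im; rewrite /m; lia.
Qed.

Lemma T_ratio (z : R) (n : int) : 0 < z -> (c%:Z - 1 <= n) ->
  Tprod (x%:R + z) n m / Tprod z n m
  = \prod_(y < x) \prod_(i < m)
      ((z + y%:R + (n%:~R - i%:R)) / (z + y%:R + i%:R)).
Proof.
move=> z0 cn; rewrite !Tprod_stepT (addrC x%:R) -[x%:R]mul1r stepT_ratio //.
  by apply: eq_bigr => y _; apply: eq_bigr => i _; rewrite !mul1r.
move=> i im; rewrite mul1r ltr_wpDr // subr_ge0 pmulrn ler_int.
by apply: le_trans cn; move: im; rewrite /m; lia.
Qed.
End Parity.

Lemma M_B_ratio x a b c :
  (M (B_region x a b c))%:R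
  = (M (P_region c c a))%:R * \prod_(y < x) notch_ratio y%:R a b c :> R.
Proof. by rewrite M_B_notch_det notch_detE M_P_proctor_det proctor_detE. Qed.
End Families.

Theorem theorem2p3 (R : realFieldType) (x a b c : nat) :
  (odd b ->
    (M (B_region x a b c))%:R =
      (M (P_region c c a))%:R
      * (Vprod (2 * x%:R + 2 * a%:R + b%:R + 2 : R) c%:Z ((c + 1) %/ 2)%N%:Z
         / Vprod (2 * a%:R + b%:R + 2 : R) c%:Z ((c + 1) %/ 2)%N%:Z)
      * ((Tprod (x%:R + 1 : R) (2 * a + b + c)%N%:Z b%:Z
          * Tprod (x%:R + a%:R + (b%:R + 3) / 2 : R)
                  (c%:Z - 1) ((c + 1) %/ 2)%N%:Z)
         / (Tprod (1 : R) (2 * a + b + c)%N%:Z b%:Z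
            * Tprod (a%:R + (b%:R + 3) / 2 : R)
                    (c%:Z - 1) ((c + 1) %/ 2)%N%:Z)))
  /\
  (~~ odd b ->
    (M (B_region x a b c))%:R =
      (M (P_region c c a))%:R
      * (Vprod (2 * x%:R + 2 * a%:R + b%:R + 3 : R)
               (c%:Z - 1) ((c + 1) %/ 2)%N%:Z
         / Vprod (2 * a%:R + b%:R + 3 : R) (c%:Z - 1) ((c + 1) %/ 2)%N%:Z)
      * ((Tprod (x%:R + 1 : R) (2 * a + b + c)%N%:Z b%:Z
          * Tprod (x%:R + a%:R + (b%:R + 2) / 2 : R)
                  c%:Z ((c + 1) %/ 2)%N%:Z)
         / (Tprod (1 : R) (2 * a + b + c)%N%:Z b%:Z
            * Tprod (a%:R + (b%:R + 2) / 2 : R)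
                    c%:Z ((c + 1) %/ 2)%N%:Z))).
Proof.
have a0 := ler0n R a; have b0 := ler0n R b.
have c0 := ler0n R c.
have eV k : 2 * x%:R + 2 * a%:R + b%:R + k = 2 * x%:R + (2 * a%:R + b%:R + k) :> R.
  by rewrite !addrA.
split=> _; rewrite M_B_ratio -mulrA; congr (_ * _); rewrite -mulf_div T1_ratio.
- rewrite eV -(addrA x%:R a%:R) V_ratio ?T_ratio //; [|lra|lra|lia].
  rewrite mulrCA -!big_split; apply: eq_bigr => y _; have y0 := ler0n R y.
  (* With [s = 2 y + 2 a + b + 2], V yields the factors over [s + 2 i], and T, after doubling, those
     over [s + 1 + 2 i]. *)
  rewrite /notch_ratio -west_ratio_pairs /=; last by lra.
  congr (_ * _); rewrite -big_split; apply: eq_bigr => i _ /=; have i0 := ler0n R i.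
  by rewrite intrB -pmulrn; pos_field.
- rewrite eV -(addrA x%:R a%:R) V_ratio ?T_ratio //; [|lra|lia|lra].
  rewrite mulrCA -!big_split; apply: eq_bigr => y _; have y0 := ler0n R y.
  (* Here V and T exchange these roles. *)
  rewrite /notch_ratio -west_ratio_pairs /=; last by lra.
  congr (_ * _); rewrite -big_split; apply: eq_bigr => i _ /=; have i0 := ler0n R i.
  by rewrite intrB -pmulrn; pos_field.
Qed.
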